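(* Let $0<\lambda<1/e$ and $E(z)=\lambda e^z$. Let $x_0>\beta$ and let $\psi:[x_0,\infty)\to(0,\infty)$ be increasing with $\psi(x)\to\infty$, $\psi(2x)=O(\psi(x))$ and $\psi(x)=o(x)$ as $x\to\infty$. Put $\Omega_\psi=\{z\in\mathbb C:\operatorname{Re}z>x_0,\ |\operatorname{Im}z|<\psi(\operatorname{Re}z)\}$ and $\mathcal X=\mathcal X(x_0,\psi)=\{z\in\mathbb C:\operatorname{Re}E^k(z)>E^k(x_0)\text{ and }E^k(z)\in\Omega_\psi\text{ for all }k\in\mathbb N\}$. Let $h:(0,t_0)\to(0,\infty)$ be a gauge function of the form $h(t)=t/p(1/t)$, where $p:(1/t_0,\infty)\to(0,\infty)$ is increasing and $t\mapsto t\,p(1/t)$ is increasing, and let $\delta>0$. Then: (i) if $p\!\left(\frac{t(\log t)^{1+\delta}}{\psi(t)}\right)\le\psi(\log t)$ for all sufficiently large $t$, then $\mathcal H^h(\mathcal X)=\infty$; (ii) if $p\!\left(\frac{t\log t}{\psi(t)}\right)\ge(\log t)^{1+\delta}$ for all sufficiently large $t$, then $\mathcal H^h(\mathcal X)=0$.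
   Context: For $0<\lambda<1/e$, $E(z)=\lambda e^z$ has real fixed points $\alpha<1<\beta$, with $\beta$ repelling. $E^k$ denotes the $k$-th iterate. A gauge function is an increasing continuous $h:(0,t_0)\to(0,\infty)$ with $h(t)\to0$ as $t\to0$, and $\mathcal H^h(A)=\lim_{\delta\to0}\inf\sum_kh(\operatorname{diam}A_k)$, the infimum over countable covers of $A$ by sets of diameter $<\delta$. *)

(* Defs.v *)
From Stdlib Require Import Reals Lra.
Open Scope R_scope.

Definition C := (R * R)%type.

Definition cdist (z w : C) : R :=
  sqrt ((fst z - fst w)^2 + (snd z - snd w)^2).

Definition Emap (lam : R) (z : C) : C :=
  (lam * exp (fst z) * cos (snd z), lam * exp (fst z) * sin (snd z)).

Definition Eiter (lam : R) (k : nat) (z : C) : C := Nat.iter k (Emap lam) z.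

Definition Omega (x0 : R) (psi : R -> R) (z : C) : Prop :=
  fst z > x0 /\ Rabs (snd z) < psi (fst z).

Definition Xset (lam x0 : R) (psi : R -> R) (z : C) : Prop :=
  forall k : nat,
    fst (Eiter lam k z) > fst (Eiter lam k (x0, 0)) /\
    Omega x0 psi (Eiter lam k z).

Definition is_diam (A : C -> Prop) (d : R) : Prop :=
  ((forall z, ~ A z) /\ d = 0) \/
  ((exists z, A z) /\
   is_lub (fun r => exists z w, A z /\ A w /\ r = cdist z w) d).

Definition hval (h : R -> R) (t : R) : R := if Rle_dec t 0 then 0 else h t.

Definition delta_cover (A : C -> Prop) (delta : R)
    (U : nat -> C -> Prop) (d : nat -> R) : Prop :=
  (forall z, A z -> exists k, U k z) /\
  (forall k, is_diam (U k) (d k) /\ d k < delta).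

(* H^h(A) = 0, i.e. H^h_delta(A) = 0 for every small delta *)
Definition Hh_zero (h : R -> R) (t0 : R) (A : C -> Prop) : Prop :=
  forall delta, 0 < delta < t0 -> forall eps, eps > 0 ->
    exists U d, delta_cover A delta U d /\
      forall n, sum_f_R0 (fun k => hval h (d k)) n <= eps.

(* H^h(A) = +infinity, i.e. H^h_delta(A) -> +infinity as delta -> 0 *)
Definition Hh_infinite (h : R -> R) (t0 : R) (A : C -> Prop) : Prop :=
  forall M : R, exists delta, 0 < delta < t0 /\
    forall U d, delta_cover A delta U d ->
      exists n, sum_f_R0 (fun k => hval h (d k)) n >= M.

(* Main.v *)
(* Write X(r) = lam e^r, so that E maps the strip {r <= Re z <= r + 1} to moduli between
   X(r) and e X(r). Over such a strip there are about psi(r) components of the preimage of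
   Omega_psi, E expands each of them by a factor of order X(r), and its image is a union of
   about X(r) strips of width one. On a narrow strip E expands uniformly,
   |E z - E w| >= X(r) |z - w| / 2, so everything is governed by counting.

   Measure zero: let B_n(r) be the cost of covering the part of X over [r, r + 1] by pulling
   back a cover n times. Then B_(n+1)(r) <= C r sup B_n(r') over r' >= X(r) / 2. Pulling back
   squares of side psi by two steps costs at most C r / X(r)^delta <= 1 / r by the hypothesis
   on p, whence B_n(r) <= 2^-n / r for large r. Finitely many further pull-backs reach x0.

   Measure infinity: distribute unit mass uniformly along the tree of boxes whose branches are
   (component, unit strip). A set of diameter d, magnified by s until its diameter exceeds
   1 / X, has mass at most C d / p(s / d), and every magnification step improves the bound by
   a factor of order 1 / psi(r); so starting at a large r gives mass at most eps h(d). If the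
   masses of a family of sets add up to less than one, then some child of the root box inherits
   this property, and iterating leads to a point of X in the interior of none of the sets. *)

From Stdlib Require Import Reals ZArith Lra Lia Psatz Cantor Classical ClassicalEpsilon.
Require Import Defs.
Open Scope R_scope.

(** * Finite sums and elementary estimates *)

(** The exponent [1 + delta] comes from the magnification. When a set is examined at a box at [r],
    it has been stretched by the product of the earlier radii. The last of these is comparable with
    [r], hence with [ln (X r)], and the others are far smaller, so the product stays below
    [ln (X r)] to the power [1 + delta]; this is the factor in the hypothesis of the first half. In
    the second half the surplus [ln (X r1)] to the power [delta], with [r1] of order [X r], beats
    every power of [r].

    No measure is constructed. [mass n] weighs the boxes of generation [n] met by an arbitrary set,
    and finite averages over children do the work of additivity and compactness. The price is that a
    box counts as soon as it is touched and that the limit point is only known to lie in no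
    interior. The covering sets are therefore thickened before their mass is estimated, which the
    doubling property of the gauge makes affordable. *)

Fixpoint rsum (f : nat -> R) (n : nat) : R :=
  match n with O => 0 | S m => rsum f m + f m end.

(** [sum_f_R0] always contains the term of index 0; [rsum] counts terms, so inductions can start
    from the empty sum. *)
Lemma rsum_sum_f_R0 f n : sum_f_R0 f n = rsum f (S n).
Proof. induction n as [|n IH]; simpl in *; [ring | rewrite IH; ring]. Qed.

Lemma rsum_le f g n : (forall i, (i < n)%nat -> f i <= g i) -> rsum f n <= rsum g n.
Proof.
  induction n as [|n IH]; intros H; simpl; [lra|].
  assert (f n <= g n) by (apply H; lia).
  assert (rsum f n <= rsum g n) by (apply IH; intros; apply H; lia). lra.
Qed.

Lemma rsum_ext f g n : (forall i, (i < n)%nat -> f i = g i) -> rsum f n = rsum g n.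
Proof.
  intros H; apply Rle_antisym; apply rsum_le; intros i Hi; rewrite (H i Hi); lra.
Qed.

Lemma rsum_const c n : rsum (fun _ => c) n = INR n * c.
Proof. induction n as [|n IH]; [simpl; ring | rewrite S_INR; simpl; rewrite IH; ring]. Qed.

Lemma rsum_nonneg f n : (forall i, (i < n)%nat -> 0 <= f i) -> 0 <= rsum f n.
Proof.
  intros H. apply Rle_trans with (rsum (fun _ => 0) n).
  - rewrite rsum_const; lra.
  - now apply rsum_le.
Qed.

Lemma rsum_plus f g n : rsum (fun i => f i + g i) n = rsum f n + rsum g n.
Proof. induction n as [|n IH]; simpl; [ring | rewrite IH; ring]. Qed.

Lemma rsum_scal c f n : rsum (fun i => c * f i) n = c * rsum f n.
Proof. induction n as [|n IH]; simpl; [ring | rewrite IH; ring]. Qed.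

Lemma rsum_exchange (f : nat -> nat -> R) m n :
  rsum (fun i => rsum (f i) m) n = rsum (fun j => rsum (fun i => f i j) n) m.
Proof.
  induction n as [|n IH]; simpl.
  - rewrite rsum_const; ring.
  - now rewrite IH, rsum_plus.
Qed.

Lemma rsum_incr f n m :
  (forall i, 0 <= f i) -> (n <= m)%nat -> rsum f n <= rsum f m.
Proof.
  intros Hf Hnm; induction Hnm as [|m Hnm IH]; simpl; [lra|]. specialize (Hf m); lra.
Qed.

Lemma rsum_term_le f n k : (forall i, 0 <= f i) -> (k < n)%nat -> f k <= rsum f n.
Proof.
  intros Hf Hk. apply Rle_trans with (rsum f (S k)).
  - simpl. assert (0 <= rsum f k) by (apply rsum_nonneg; auto). lra.
  - apply rsum_incr; [auto | lia].
Qed.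

Lemma rsum_indicator c a n :
  0 <= c -> rsum (fun m => if Nat.eqb m a then c else 0) n <= c.
Proof.
  intros Hc.
  assert (rsum (fun m => if Nat.eqb m a then c else 0) n = if Nat.ltb a n then c else 0).
  { induction n as [|n IH]; [reflexivity|]. simpl rsum. rewrite IH.
    destruct (Nat.ltb_spec a n), (Nat.ltb_spec a (S n)), (Nat.eqb_spec n a); try lia; lra. }
  rewrite H. destruct (Nat.ltb a n); lra.
Qed.

(* Since [i, k <= m] whenever [of_nat m = (i, k)], the first [n] codes lie in the
   square [n * n]. *)
Lemma rsum_cantor (f : nat -> nat -> R) n :
  (forall i k, 0 <= f i k) ->
  rsum (fun m => f (fst (of_nat m)) (snd (of_nat m))) n
  <= rsum (fun i => rsum (f i) n) n.
Proof.
  intros Hf.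
  set (ind := fun m i k => if Nat.eqb m (to_nat (i, k)) then f i k else 0).
  assert (Hind : forall m i k, 0 <= ind m i k).
  { intros; unfold ind; destruct (Nat.eqb _ _); [apply Hf | lra]. }
  apply Rle_trans with (rsum (fun m => rsum (fun i => rsum (ind m i) n) n) n).
  - apply rsum_le; intros m Hm.
    destruct (of_nat m) as [i k] eqn:E; simpl.
    assert (Em : to_nat (i, k) = m) by (rewrite <- E; apply cancel_to_of).
    assert (Hik := to_nat_non_decreasing i k).
    apply Rle_trans with (rsum (ind m i) n).
    + apply Rle_trans with (ind m i k).
      * unfold ind; rewrite Em, Nat.eqb_refl; lra.
      * apply rsum_term_le; [auto | lia].
    + apply (rsum_term_le (fun i => rsum (ind m i) n)); [|lia].
      intros; apply rsum_nonneg; auto.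
  - rewrite rsum_exchange. apply rsum_le; intros i Hi.
    rewrite rsum_exchange. apply rsum_le; intros k Hk.
    unfold ind. now apply rsum_indicator.
Qed.

(** At most [Rmax 0 (INR n - b)] integers are at least [b] and less than [n]. *)
Lemma rsum_window_aux f B b n :
  0 <= B -> (forall i, (i < n)%nat -> 0 <= f i <= B) ->
  (forall i, (i < n)%nat -> f i <> 0 -> b <= INR i) ->
  rsum f n <= B * Rmax 0 (INR n - b).
Proof.
  intros HB. induction n as [|n IH]; intros Hf Hw.
  - simpl. apply Rmult_le_pos; [lra | apply Rmax_l].
  - simpl rsum. rewrite S_INR.
    assert (IH' : rsum f n <= B * Rmax 0 (INR n - b)).
    { apply IH; intros; [apply Hf | apply Hw]; auto; lia. }
    assert (Hfn : 0 <= f n <= B) by (apply Hf; lia).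
    destruct (Req_dec (f n) 0) as [E|E].
    + assert (B * Rmax 0 (INR n - b) <= B * Rmax 0 (INR n + 1 - b)).
      { apply Rmult_le_compat_l; [lra|]. apply Rle_max_compat_l; lra. }
      lra.
    + assert (b <= INR n) by (apply Hw; auto).
      rewrite Rmax_right in * by lra. nra.
Qed.

(** A window of length [a] holds at most [a + 1] indices. In the induction a zero last term is
    dropped; otherwise the last index anchors the window. *)
Lemma rsum_window f B a n :
  0 <= B -> 0 <= a -> (forall i, (i < n)%nat -> 0 <= f i <= B) ->
  (forall i i', (i < n)%nat -> (i' < n)%nat -> f i <> 0 -> f i' <> 0 ->
     INR i' - INR i <= a) ->
  rsum f n <= (a + 1) * B.
Proof.
  intros HB Ha. induction n as [|n IH]; intros Hf Hw.
  - simpl; nra.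
  - destruct (Req_dec (f n) 0) as [E|E].
    + simpl; rewrite E, Rplus_0_r. apply IH; intros; [apply Hf | apply Hw]; auto; lia.
    + assert (H := rsum_window_aux f B (INR n - a) (S n) HB Hf).
      rewrite S_INR in H. rewrite Rmax_right in H by lra.
      replace ((a + 1) * B) with (B * (INR n + 1 - (INR n - a))) by ring.
      apply H. intros i Hi Hfi. assert (INR n - INR i <= a) by (apply Hw; auto; lia). lra.
Qed.

Lemma rsum_lt f g n :
  (0 < n)%nat -> (forall i, (i < n)%nat -> f i < g i) -> rsum f n < rsum g n.
Proof.
  intros Hn H. destruct n as [|n]; [lia|]. simpl.
  assert (f n < g n) by (apply H; lia).
  assert (rsum f n <= rsum g n) by (apply rsum_le; intros; left; apply H; lia). lra.
Qed.

Lemma rsum_geom n : rsum (pow (/ 2)) n <= 2.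
Proof.
  assert (rsum (pow (/ 2)) n = 2 - 2 * (/ 2) ^ n).
  { induction n as [|n IH]; simpl; [ring | rewrite IH; field]. }
  assert (0 < (/ 2) ^ n) by (apply pow_lt; lra). lra.
Qed.

Lemma bounded_choice (P : nat -> nat -> Prop) n :
  (forall i k k', (k <= k')%nat -> P i k -> P i k') ->
  (forall i, (i < n)%nat -> exists k, P i k) ->
  exists k, forall i, (i < n)%nat -> P i k.
Proof.
  intros Hm. induction n as [|n IH]; intros H.
  - exists 0%nat; intros; lia.
  - destruct IH as [k Hk]; [auto with arith|]. destruct (H n) as [k' Hk']; [lia|].
    exists (max k k'); intros i Hi. destruct (Nat.eq_dec i n) as [->|].
    + apply Hm with k'; auto; lia.
    + apply Hm with k; [lia | apply Hk; lia].
Qed.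

(** [up x] is the least integer strictly above [x]. Negative arguments are sent to 0, whence the
    hypothesis of [nfloor_spec]. *)
Definition nfloor (x : R) : nat := Z.to_nat (up x - 1).

Lemma nfloor_spec x : 0 <= x -> INR (nfloor x) <= x < INR (nfloor x) + 1.
Proof.
  intros Hx. unfold nfloor. destruct (archimed x) as [H1 H2].
  assert (0 < up x)%Z by (apply lt_IZR; lra).
  rewrite INR_IZR_INZ, Z2Nat.id by lia. rewrite minus_IZR. lra.
Qed.

(** * Distortion of the exponential map and its inverse branches *)

Lemma abs_diff_exp_le x y B :
  exp x <= B -> exp y <= B -> Rabs (exp x - exp y) <= B * Rabs (x - y).
Proof.
  assert (H : forall u v, u <= v -> exp v <= B -> 0 <= exp v - exp u <= B * (v - u)).
  { intros u v Huv Hv. assert (0 < exp v) by apply exp_pos.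
    assert (exp u = exp v * exp (u - v)) by (rewrite <- exp_plus; f_equal; ring).
    assert (H1 := exp_ineq1_le (u - v)).
    assert (H2 : exp (u - v) <= 1) by (rewrite <- exp_0; destruct Huv; [left; apply exp_increasing; lra | right; f_equal; lra]).
    split; nra. }
  intros Hx Hy. destruct (Rle_dec x y) as [L|L].
  - destruct (H x y L Hy). rewrite !Rabs_left1 by lra. lra.
  - destruct (H y x ltac:(lra) Hx). rewrite !Rabs_right by lra. lra.
Qed.

Lemma abs_diff_cos_le x y : Rabs (cos x - cos y) <= Rabs (x - y).
Proof.
  destruct (MVT_abs cos (fun c => - sin c) y x) as [c [Hc _]].
  { intros; apply derivable_pt_lim_cos. }
  rewrite Hc. assert (Rabs (- sin c) <= 1).
  { apply Rabs_le. destruct (SIN_bound c); lra. }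
  assert (0 <= Rabs (x - y)) by apply Rabs_pos. nra.
Qed.

Lemma abs_diff_sin_le x y : Rabs (sin x - sin y) <= Rabs (x - y).
Proof.
  destruct (MVT_abs sin cos y x) as [c [Hc _]].
  { intros; apply derivable_pt_lim_sin. }
  rewrite Hc. assert (Rabs (cos c) <= 1).
  { apply Rabs_le. destruct (COS_bound c); lra. }
  assert (0 <= Rabs (x - y)) by apply Rabs_pos. nra.
Qed.

(** Product rule: the change of radius and the change of angle contribute [L * d] each. [f] stands
    for cosine or sine. *)
Lemma polar_lip (f : R -> R) lam L d x y x' y' :
  0 < lam -> (forall t, Rabs (f t) <= 1) -> (forall s t, Rabs (f s - f t) <= Rabs (s - t)) ->
  lam * exp x <= L -> lam * exp x' <= L -> Rabs (x - x') <= d -> Rabs (y - y') <= d ->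
  Rabs (lam * exp x * f y - lam * exp x' * f y') <= 2 * L * d.
Proof.
  intros Hl Hf1 Hf2 H1 H2 Hx Hy.
  replace (lam * exp x * f y - lam * exp x' * f y')
    with ((lam * (exp x - exp x')) * f y + lam * exp x' * (f y - f y')) by ring.
  eapply Rle_trans; [apply Rabs_triang|]. rewrite !Rabs_mult.
  assert (0 < exp x') by apply exp_pos.
  assert (Hd := abs_diff_exp_le x x' (L / lam)).
  rewrite (Rabs_right lam), (Rabs_right (exp x')) by lra.
  assert (Hd' : Rabs (exp x - exp x') <= L / lam * Rabs (x - x')).
  { apply Hd; apply Rmult_le_reg_l with lam; auto; field_simplify; lra. }
  specialize (Hf1 y). specialize (Hf2 y y').
  assert (0 <= Rabs (f y)) by apply Rabs_pos.
  assert (0 <= Rabs (exp x - exp x')) by apply Rabs_pos.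
  assert (0 <= Rabs (f y - f y')) by apply Rabs_pos.
  assert (0 <= Rabs (x - x')) by apply Rabs_pos.
  assert (0 < lam * exp x') by nra.
  assert (lam * Rabs (exp x - exp x') <= L * d).
  { apply Rle_trans with (lam * (L / lam * Rabs (x - x'))).
    - apply Rmult_le_compat_l; lra.
    - replace (lam * (L / lam * Rabs (x - x'))) with (L * Rabs (x - x')) by (field; lra). nra. }
  assert (lam * Rabs (exp x - exp x') * Rabs (f y) <= L * d * 1).
  { apply Rmult_le_compat; auto. apply Rmult_le_pos; lra. }
  assert (lam * exp x' * Rabs (f y - f y') <= L * d).
  { apply Rmult_le_compat; lra. }
  lra.
Qed.

(** Sup-norm distance: columns are counted by real parts and rows by imaginary parts, so each
    coordinate is controlled on its own. *)
Definition close (d : R) (z w : C) : Prop :=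
  Rabs (fst z - fst w) <= d /\ Rabs (snd z - snd w) <= d.

Lemma Emap_lip lam L d z w :
  0 < lam -> lam * exp (fst z) <= L -> lam * exp (fst w) <= L ->
  close d z w -> close (2 * L * d) (Emap lam z) (Emap lam w).
Proof.
  intros Hl Hz Hw [H1 H2]. split; simpl; apply polar_lip; auto.
  - intros; apply Rabs_le; destruct (COS_bound t); lra.
  - apply abs_diff_cos_le.
  - intros; apply Rabs_le; destruct (SIN_bound t); lra.
  - apply abs_diff_sin_le.
Qed.

(** Taylor expansion to degree four. The 8 is what [Emap_expand] offers: squaring its factor 2 turns
    the angular part into [8 a b (1 - cos t)]. *)
Lemma one_sub_cos_ge t : Rabs t <= 2 -> t ^ 2 <= 8 * (1 - cos t).
Proof.
  intros Ht. assert (-2 <= t <= 2) by (unfold Rabs in Ht; destruct (Rcase_abs t); lra).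
  destruct (pre_cos_bound t 0) as [_ H1]; try lra.
  unfold cos_approx, cos_term in H1. simpl in H1.
  assert (0 <= t * t <= 4) by nra.
  assert (cos t <= 1 - t * t / 2 + (t * t) * (t * t) / 24) by lra.
  nra.
Qed.

Lemma cdist_pos z w : 0 <= cdist z w.
Proof. apply sqrt_pos. Qed.

Lemma cdist_sqr z w : cdist z w ^ 2 = (fst z - fst w) ^ 2 + (snd z - snd w) ^ 2.
Proof. unfold cdist. apply pow2_sqrt. apply Rplus_le_le_0_compat; apply pow2_ge_0. Qed.

Lemma sqr_le_reg a b : 0 <= b -> a ^ 2 <= b ^ 2 -> a <= b.
Proof. intros; nra. Qed.

Lemma cdist_le z w d : close d z w -> cdist z w <= 2 * d.
Proof.
  intros [H1 H2]. assert (0 <= Rabs (fst z - fst w)) by apply Rabs_pos.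
  apply sqr_le_reg; [lra|]. rewrite cdist_sqr, <- (pow2_abs (fst z - fst w)), <- (pow2_abs (snd z - snd w)).
  assert (0 <= Rabs (snd z - snd w)) by apply Rabs_pos. nra.
Qed.

Lemma close_cdist z w : close (cdist z w) z w.
Proof.
  assert (H := cdist_sqr z w). assert (H0 := cdist_pos z w).
  assert (0 <= (fst z - fst w) ^ 2) by apply pow2_ge_0.
  assert (0 <= (snd z - snd w) ^ 2) by apply pow2_ge_0.
  split; apply sqr_le_reg; auto; rewrite pow2_abs; lra.
Qed.

(* [|E z - E w|^2 = (a - b)^2 + 2 a b (1 - cos t)] with [a = |E z|], [b = |E w|] and
   [t = Im z - Im w]. *)
Lemma Emap_expand lam L z w :
  0 < L -> L <= lam * exp (fst z) -> L <= lam * exp (fst w) ->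
  Rabs (snd z - snd w) <= 2 ->
  L * cdist z w <= 2 * cdist (Emap lam z) (Emap lam w).
Proof.
  intros HL Hz Hw Ht. apply sqr_le_reg.
  { assert (H := cdist_pos (Emap lam z) (Emap lam w)); lra. }
  rewrite !Rpow_mult_distr, !cdist_sqr. simpl fst; simpl snd.
  set (t := snd z - snd w) in *.
  assert (H1 := one_sub_cos_ge t Ht).
  assert (Hc : cos t = cos (snd z) * cos (snd w) + sin (snd z) * sin (snd w)) by apply cos_minus.
  set (a := lam * exp (fst z)) in *. set (b := lam * exp (fst w)) in *.
  assert (Hza := sin2_cos2 (snd z)). assert (Hwa := sin2_cos2 (snd w)). unfold Rsqr in *.
  assert (Hab : L ^ 2 * (fst z - fst w) ^ 2 <= (a - b) ^ 2).
  { assert (H : forall u v, L <= lam * exp u -> u <= v -> L * (v - u) <= lam * exp v - lam * exp u).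
    { intros u v Hu Huv. replace v with (u + (v - u)) at 2 by ring. rewrite exp_plus.
      assert (He := exp_ineq1_le (v - u)). nra. }
    destruct (Rle_dec (fst z) (fst w)) as [Hle|Hle].
    - specialize (H _ _ Hz Hle). fold a b in H.
      replace (L ^ 2 * (fst z - fst w) ^ 2) with ((L * (fst w - fst z)) ^ 2) by ring.
      replace ((a - b) ^ 2) with ((b - a) ^ 2) by ring.
      apply pow_incr; split; [nra | lra].
    - specialize (H _ _ Hw (Rlt_le _ _ (Rnot_le_lt _ _ Hle))). fold a b in H.
      replace (L ^ 2 * (fst z - fst w) ^ 2) with ((L * (fst z - fst w)) ^ 2) by ring.
      apply pow_incr; split; [nra | lra]. }
  assert (Hexp : (a * cos (snd z) - b * cos (snd w)) ^ 2 + (a * sin (snd z) - b * sin (snd w)) ^ 2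
     = (a - b) ^ 2 + 2 * (a * b) * (1 - cos t)).
  { rewrite Hc.
    transitivity (a ^ 2 * (sin (snd z) * sin (snd z) + cos (snd z) * cos (snd z))
      + b ^ 2 * (sin (snd w) * sin (snd w) + cos (snd w) * cos (snd w))
      - 2 * (a * b) * (cos (snd z) * cos (snd w) + sin (snd z) * sin (snd w))).
    - ring.
    - rewrite Hza, Hwa; ring. }
  rewrite Hexp.
  assert (HLab : L ^ 2 <= a * b) by (simpl; rewrite Rmult_1_r; apply Rmult_le_compat; lra).
  assert (0 <= 1 - cos t) by (destruct (COS_bound t); lra).
  assert (L ^ 2 * t ^ 2 <= (a * b) * (8 * (1 - cos t))).
  { apply Rmult_le_compat; auto; nra. }
  assert (0 <= (a - b) ^ 2) by apply pow2_ge_0.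
  lra.
Qed.

(* The inverse branch of [E] on the right half-plane with values near [Im z = 2 PI j]. *)
Definition Ebranch (lam : R) (j : nat) (w : C) : C :=
  (ln (sqrt (fst w ^ 2 + snd w ^ 2) / lam), atan (snd w / fst w) + 2 * INR j * PI).

Lemma Emap_Ebranch lam j w : 0 < lam -> 0 < fst w -> Emap lam (Ebranch lam j w) = w.
Proof.
  intros Hl Hw. destruct w as [x y]; unfold Emap, Ebranch; simpl fst in *; simpl snd.
  assert (Hp : 0 < x ^ 2 + y ^ 2) by nra.
  assert (Hs : 0 < sqrt (x ^ 2 + y ^ 2)) by now apply sqrt_lt_R0.
  rewrite exp_ln by now apply Rdiv_lt_0_compat.
  rewrite cos_period, sin_period, cos_atan, sin_atan.
  assert (E : sqrt (1 + (y / x)²) = sqrt (x ^ 2 + y ^ 2) / x).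
  { replace (1 + (y / x)²) with ((x ^ 2 + y ^ 2) / x ^ 2) by (unfold Rsqr; field; lra).
    rewrite sqrt_div_alt by (apply pow_lt; lra). now rewrite sqrt_pow2 by lra. }
  rewrite E. simpl pow in *. f_equal; field; repeat split; lra.
Qed.

Lemma atan_abs_le1 u : Rabs u <= 1 -> Rabs (atan u) <= 1.
Proof.
  intros Hu. assert (-1 <= u <= 1) by (unfold Rabs in Hu; destruct (Rcase_abs u); lra).
  assert (atan u <= atan 1) by (destruct (Req_dec u 1) as [->|]; [lra | left; apply atan_increasing; lra]).
  assert (atan (-1) <= atan u) by (destruct (Req_dec u (-1)) as [->|]; [lra | left; apply atan_increasing; lra]).
  replace (-1) with (Ropp 1) in * by ring. rewrite atan_opp, atan_1 in *. assert (H5 := PI_4).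
  apply Rabs_le; lra.
Qed.

(** * Limits of sequences in the plane *)

Lemma Un_cv_le_bound u l b N : Un_cv u l -> (forall n, (N <= n)%nat -> u n <= b) -> l <= b.
Proof.
  intros Hu Hb. destruct (Rle_dec l b) as [|Hn]; auto.
  destruct (Hu (l - b)) as [N' HN']; [lra|].
  specialize (HN' (max N N') (Nat.le_max_r N N')). specialize (Hb (max N N') (Nat.le_max_l N N')).
  unfold Rdist, Rabs in HN'. destruct (Rcase_abs _); lra.
Qed.

Lemma Un_cv_abs_bound u l c b N :
  Un_cv u l -> (forall n, (N <= n)%nat -> Rabs (u n - c) <= b) -> Rabs (l - c) <= b.
Proof.
  intros Hu Hb. apply Rabs_le. split.
  - assert (- l <= b - c); [|lra].
    apply (Un_cv_le_bound (opp_seq u) _ _ N); [now apply CV_opp|].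
    intros n Hn; specialize (Hb n Hn). unfold opp_seq, Rabs in *. destruct (Rcase_abs _); lra.
  - assert (l <= b + c); [|lra].
    apply (Un_cv_le_bound u _ _ N); auto.
    intros n Hn; specialize (Hb n Hn). unfold Rabs in *. destruct (Rcase_abs _); lra.
Qed.

Definition Ccv (u : nat -> C) (z : C) : Prop :=
  Un_cv (fun n => fst (u n)) (fst z) /\ Un_cv (fun n => snd (u n)) (snd z).

Lemma Ccv_Emap lam u z : Ccv u z -> Ccv (fun n => Emap lam (u n)) (Emap lam z).
Proof.
  intros [H1 H2].
  assert (Hexp : Un_cv (fun n => lam * exp (fst (u n))) (lam * exp (fst z))).
  { apply (CV_mult (fun _ => lam) (fun n => exp (fst (u n)))).
    - intros e He; exists 0%nat; intros; unfold Rdist; rewrite Rminus_diag, Rabs_R0; lra.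
    - apply (continuity_seq exp (fun n => fst (u n))); auto. apply derivable_continuous, derivable_exp. }
  split; simpl.
  - apply (CV_mult (fun n => lam * exp (fst (u n))) (fun n => cos (snd (u n)))); auto.
    apply (continuity_seq cos (fun n => snd (u n))); auto. apply continuity_cos.
  - apply (CV_mult (fun n => lam * exp (fst (u n))) (fun n => sin (snd (u n)))); auto.
    apply (continuity_seq sin (fun n => snd (u n))); auto. apply continuity_sin.
Qed.

Lemma Ccv_Eiter lam m u z : Ccv u z -> Ccv (fun n => Eiter lam m (u n)) (Eiter lam m z).
Proof.
  intros H. induction m as [|m IH]; [exact H|].
  apply (Ccv_Emap lam (fun n => Eiter lam m (u n))); auto.
Qed.

Lemma Ccv_complete (u : nat -> C) (b : nat -> R) :
  (forall e, 0 < e -> exists N, b N < e) ->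
  (forall N n n', (N <= n)%nat -> (N <= n')%nat -> close (b N) (u n) (u n')) ->
  exists z, Ccv u z.
Proof.
  intros Hb Hu.
  destruct (R_complete (fun n => fst (u n))) as [x Hx].
  { intros e He. destruct (Hb e He) as [N HN]. exists N; intros n n' Hn Hn'.
    destruct (Hu N n n'); auto. unfold Rdist; lra. }
  destruct (R_complete (fun n => snd (u n))) as [y Hy].
  { intros e He. destruct (Hb e He) as [N HN]. exists N; intros n n' Hn Hn'.
    destruct (Hu N n n'); auto. unfold Rdist; lra. }
  exists (x, y); split; auto.
Qed.

(** [Nat.iter] exposes the last step of an orbit, whereas pull-backs undo the first one. *)
Lemma Eiter_Emap lam m z : Eiter lam m (Emap lam z) = Eiter lam (S m) z.
Proof. induction m as [|m IH]; [reflexivity|]. simpl. f_equal. exact IH. Qed.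

(** * Mass on the tree of boxes *)

(* The radius of the circle onto which [E] maps the line [Re z = r]. *)
Definition rad (lam r : R) : R := lam * exp r.

Lemma rad_pos lam r : 0 < lam -> 0 < rad lam r.
Proof. intros; apply Rmult_lt_0_compat; [auto | apply exp_pos]. Qed.

Lemma exp_le_mono x y : x <= y -> exp x <= exp y.
Proof. intros [H | ->]; [left; now apply exp_increasing | right; reflexivity]. Qed.

Lemma rad_le lam r s : 0 < lam -> r <= s -> rad lam r <= rad lam s.
Proof.
  intros Hl H. apply Rmult_le_compat_l; [lra|]. now apply exp_le_mono.
Qed.

Lemma rad_succ lam r : 0 < lam -> 2 * rad lam r <= rad lam (r + 1) <= 3 * rad lam r.
Proof.
  intros Hl. assert (H := rad_pos lam r Hl). unfold rad in *. rewrite exp_plus.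
  assert (H1 := exp_ineq1_le 1). assert (H2 := exp_le_3). nra.
Qed.

Lemma ln_rad lam r : 0 < lam -> ln (rad lam r) = ln lam + r.
Proof. intros; unfold rad; rewrite ln_mult, ln_exp; auto; apply exp_pos. Qed.

Lemma ln_le_mono x y : 0 < x -> x <= y -> ln x <= ln y.
Proof. intros H [H1 | ->]; [left; now apply ln_increasing | right; reflexivity]. Qed.

Section MassOnTree.
Context (lam : R) (psi : R -> R) (R0 : R).
(** All these hypotheses hold once [R0] is large. The number 433 leaves at least 432 rows after
    rounding down, and 432 is the constant lost by one magnification in [mass_bound_zoom]. *)
Context (lam_pos : 0 < lam)
  (rad_ge : forall r, R0 <= r -> R0 <= rad lam r /\ 12 <= rad lam r)
  (psi_incr : forall x y, R0 <= x <= y -> psi x <= psi y)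
  (psi_small : forall x, R0 <= x -> psi x <= x / 4)
  (psi_big : forall x, R0 <= x -> 16 * 433 <= psi x).

Notation X := (rad lam).

(* Branches are [2 PI <= 8] apart, so the first [psi r / 16] of them stay in
   [|Im z| <= psi r / 2]; real parts up to [3 X r / 2] keep moduli below [2 X r <= X (r + 1)]. *)
Definition nrows (r : R) : nat := nfloor (psi r / 16).
Definition ncols (r : R) : nat := nfloor (X r / 2).

(** Only half of the allowed height is used: a limit point inherits closed inequalities, while
    [Omega] asks for a strict one. *)
Definition Box (r : R) (w : C) : Prop :=
  r <= fst w <= r + 1 /\ Rabs (snd w) <= psi r / 2.

Lemma nrows_spec r : R0 <= r -> 432 <= INR (nrows r) /\ 16 * INR (nrows r) <= psi r <= 17 * INR (nrows r).
Proof.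
  intros Hr. assert (H := psi_big r Hr). unfold nrows.
  destruct (nfloor_spec (psi r / 16)); lra.
Qed.

Lemma ncols_spec r : R0 <= r -> 1 <= INR (ncols r) /\ 2 * INR (ncols r) <= X r <= 3 * INR (ncols r).
Proof.
  intros Hr. destruct (rad_ge r Hr). unfold ncols.
  destruct (nfloor_spec (X r / 2)); lra.
Qed.

Lemma child_ge r i : R0 <= r -> R0 <= X r + INR i.
Proof. intros Hr. destruct (rad_ge r Hr). assert (H1 := pos_INR i). lra. Qed.

Lemma lt_INR_succ i n : (i < n)%nat -> INR i + 1 <= INR n.
Proof. intros H. rewrite <- S_INR. apply le_INR. lia. Qed.

Lemma Box_sector r i w : R0 <= r -> Box (X r + INR i) w ->
  0 < fst w /\ Rabs (snd w) <= fst w / 8.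
Proof.
  intros Hr [H1 H2]. destruct (rad_ge r Hr). assert (H3 := pos_INR i).
  assert (H4 := psi_small _ (child_ge r i Hr)). split; lra.
Qed.

Lemma Ebranch_snd r i j w : R0 <= r -> Box (X r + INR i) w ->
  Rabs (snd (Ebranch lam j w) - 2 * INR j * PI) <= 1.
Proof.
  intros Hr Hw. destruct (Box_sector r i w Hr Hw) as [H1 H2]. simpl.
  replace (atan (snd w / fst w) + 2 * INR j * PI - 2 * INR j * PI) with (atan (snd w / fst w)) by ring.
  apply atan_abs_le1. unfold Rdiv. rewrite Rabs_mult, Rabs_inv, (Rabs_right (fst w)) by lra.
  apply Rmult_le_reg_r with (fst w); auto. field_simplify; lra.
Qed.

(** The real part of [w] lies between [X r] and [3 * X r / 2], and [w] lies in a narrow sector, so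
    its modulus is between [X r] and [2 * X r], hence at most [X (r + 1)]. The last row ends below
    height [8 * nrows r]. *)
Lemma Ebranch_Box r i j w : R0 <= r -> (i < ncols r)%nat -> (j < nrows r)%nat ->
  Box (X r + INR i) w -> Box r (Ebranch lam j w).
Proof.
  intros Hr Hi Hj Hw.
  destruct (Box_sector r i w Hr Hw) as [Hw1 Hw2].
  assert (Hs := Ebranch_snd r i j w Hr Hw).
  apply lt_INR_succ in Hi, Hj. destruct (ncols_spec r Hr) as [_ HK].
  destruct (nrows_spec r Hr) as [HN1 HN]. destruct (rad_ge r Hr) as [_ HX].
  assert (Hi0 := pos_INR i). assert (Hj0 := pos_INR j).
  destruct Hw as [Hw _]. split.
  - simpl fst. set (q := sqrt _).
    assert (Hq2 : q ^ 2 = fst w ^ 2 + snd w ^ 2).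
    { apply pow2_sqrt. apply Rplus_le_le_0_compat; apply pow2_ge_0. }
    assert (Hq0 : 0 <= q) by apply sqrt_pos.
    assert (H2 : 0 <= snd w ^ 2 <= (fst w / 8) ^ 2).
    { rewrite <- (pow2_abs (snd w)). split; [apply pow2_ge_0|]. apply pow_incr. split; [apply Rabs_pos | lra]. }
    assert (Hq1 : fst w <= q) by (apply sqr_le_reg; lra).
    assert (Hq3 : q <= 2 * X r).
    { apply sqr_le_reg; [lra|]. rewrite Hq2.
      assert (fst w ^ 2 <= (X r + X r / 2) ^ 2) by (apply pow_incr; lra). nra. }
    assert (HXr : X r / lam = exp r) by (unfold rad; field; lra).
    split.
    + rewrite <- (ln_exp r) at 1. apply ln_le_mono; [apply exp_pos|]. rewrite <- HXr.
      apply Rmult_le_compat_r; [left; now apply Rinv_0_lt_compat | lra].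
    + rewrite <- (ln_exp (r + 1)). apply ln_le_mono.
      { apply Rdiv_lt_0_compat; lra. }
      apply Rmult_le_reg_r with lam; auto. replace (q / lam * lam) with q by (field; lra).
      assert (H := rad_succ lam r lam_pos). unfold rad in *; lra.
  - assert (H3 := PI_4). assert (H4 := PI_RGT_0). revert Hs. generalize (snd (Ebranch lam j w)).
    intros v Hs.
    assert (-1 <= v - 2 * INR j * PI <= 1).
    { unfold Rabs in Hs; destruct (Rcase_abs _); lra. }
    apply Rabs_le. split; [nra|].
    assert (2 * INR j * PI <= 2 * (INR (nrows r) - 1) * 4) by (apply Rmult_le_compat; nra).
    lra.
Qed.

(** Total weight of the boxes of generation [n] under the root at [r] that [A] meets, each box
    sharing its weight equally among its children. Instead of transporting boxes to the root, [A] is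
    pulled into the coordinates of the child. No measurability of [A] is involved. *)
Fixpoint mass (n : nat) (r : R) (A : C -> Prop) : R :=
  match n with
  | O => if excluded_middle_informative (exists w, A w /\ Box r w) then 1 else 0
  | S n => / (INR (nrows r) * INR (ncols r)) *
      rsum (fun j => rsum (fun i =>
        mass n (X r + INR i) (fun w => A (Ebranch lam j w))) (ncols r)) (nrows r)
  end.

Lemma avg_pos r : R0 <= r -> 0 < / (INR (nrows r) * INR (ncols r)).
Proof.
  intros Hr. destruct (nrows_spec r Hr), (ncols_spec r Hr).
  apply Rinv_0_lt_compat, Rmult_lt_0_compat; lra.
Qed.

(** Writing a constant as an average over the children reduces comparisons with it to one child at a
    time. *)
Lemma avg_const c r : R0 <= r ->
  / (INR (nrows r) * INR (ncols r)) * rsum (fun j => rsum (fun i => c) (ncols r)) (nrows r) = c.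
Proof.
  intros Hr. destruct (nrows_spec r Hr), (ncols_spec r Hr). rewrite !rsum_const. field; lra.
Qed.

Lemma mass_nonneg n : forall r A, R0 <= r -> 0 <= mass n r A.
Proof.
  induction n as [|n IH]; intros r A Hr; simpl.
  - destruct (excluded_middle_informative _); lra.
  - apply Rmult_le_pos; [left; now apply avg_pos|].
    apply rsum_nonneg; intros; apply rsum_nonneg; intros; apply IH. now apply child_ge.
Qed.

Lemma mass_le1 n : forall r A, R0 <= r -> mass n r A <= 1.
Proof.
  induction n as [|n IH]; intros r A Hr; simpl.
  - destruct (excluded_middle_informative _); lra.
  - rewrite <- (avg_const 1 r Hr). apply Rmult_le_compat_l; [left; now apply avg_pos|].
    apply rsum_le; intros; apply rsum_le; intros; apply IH. now apply child_ge.
Qed.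

Lemma mass_disjoint n : forall r A, R0 <= r -> (forall w, Box r w -> ~ A w) -> mass n r A = 0.
Proof.
  induction n as [|n IH]; intros r A Hr H; simpl.
  - destruct (excluded_middle_informative _) as [[w [H1 H2]]|]; [destruct (H w H2 H1) | reflexivity].
  - rewrite <- (avg_const 0 r Hr). f_equal.
    apply rsum_ext; intros j Hj; apply rsum_ext; intros i Hi. apply IH; [now apply child_ge|].
    intros w Hw. apply H. now apply (Ebranch_Box r i).
Qed.

Lemma mass_full n : forall r A, R0 <= r -> (forall w, Box r w -> A w) -> mass n r A = 1.
Proof.
  induction n as [|n IH]; intros r A Hr H; simpl.
  - destruct (excluded_middle_informative _) as [|N]; [reflexivity|]. destruct N.
    assert (HB : Box r (r, 0)) by (split; simpl; [lra | rewrite Rabs_R0; assert (H1 := psi_big r Hr); lra]).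
    exists (r, 0); auto.
  - rewrite <- (avg_const 1 r Hr). f_equal.
    apply rsum_ext; intros j Hj; apply rsum_ext; intros i Hi. apply IH; [now apply child_ge|].
    intros w Hw. apply H. now apply (Ebranch_Box r i).
Qed.

(** A box missed by [A] contributes nothing at later generations, and a box met by [A] already
    counts in full. *)
Lemma mass_succ_le n : forall r A, R0 <= r -> mass (S n) r A <= mass n r A.
Proof.
  induction n as [|n IH]; intros r A Hr.
  - simpl mass at 2. destruct (excluded_middle_informative _) as [|N]; [now apply mass_le1|].
    rewrite mass_disjoint; auto; [lra|]. intros w Hw HA. apply N; exists w; auto.
  - change (mass (S n) r A) with (/ (INR (nrows r) * INR (ncols r)) *
      rsum (fun j => rsum (fun i =>
        mass n (X r + INR i) (fun w => A (Ebranch lam j w))) (ncols r)) (nrows r)).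
    change (mass (S (S n)) r A) with (/ (INR (nrows r) * INR (ncols r)) *
      rsum (fun j => rsum (fun i =>
        mass (S n) (X r + INR i) (fun w => A (Ebranch lam j w))) (ncols r)) (nrows r)).
    apply Rmult_le_compat_l; [left; now apply avg_pos|].
    apply rsum_le; intros; apply rsum_le; intros; apply IH. now apply child_ge.
Qed.

Lemma mass_le n m r A : R0 <= r -> (n <= m)%nat -> mass m r A <= mass n r A.
Proof.
  intros Hr H; induction H as [|m H IH]; [lra|].
  apply Rle_trans with (mass m r A); [now apply mass_succ_le | auto].
Qed.

(** The diameter is bounded only inside the box, because elsewhere the composition with an inverse
    branch is not controlled. *)
Definition Small (A : C -> Prop) (r d : R) : Prop :=
  forall w w', A w -> A w' -> Box r w -> Box r w' -> close d w w'.

(** [w] and [w'] are images under [E] of points of [A] in the box at [r], where radii are at most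
    [3 * X r]; [Emap_lip] supplies the remaining 2. *)
Lemma child_close r d A i i' j w w' : R0 <= r -> Small A r d ->
  (i < ncols r)%nat -> (i' < ncols r)%nat -> (j < nrows r)%nat ->
  Box (X r + INR i) w -> Box (X r + INR i') w' ->
  A (Ebranch lam j w) -> A (Ebranch lam j w') -> close (6 * X r * d) w w'.
Proof.
  intros Hr HA Hi Hi' Hj Hw Hw' HAw HAw'.
  assert (HB := Ebranch_Box r i j w Hr Hi Hj Hw).
  assert (HB' := Ebranch_Box r i' j w' Hr Hi' Hj Hw').
  destruct (Box_sector r i w Hr Hw) as [Hp _]. destruct (Box_sector r i' w' Hr Hw') as [Hp' _].
  rewrite <- (Emap_Ebranch lam j w), <- (Emap_Ebranch lam j w') by auto.
  assert (H := rad_succ lam r lam_pos).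
  replace (6 * X r * d) with (2 * (3 * X r) * d) by ring.
  apply Emap_lip; auto.
  - apply Rle_trans with (X (r + 1)); [|lra]. apply rad_le; auto. apply HB.
  - apply Rle_trans with (X (r + 1)); [|lra]. apply rad_le; auto. apply HB'.
Qed.

(** Row [j] stays within 1 of height [2 * PI * j], and [2 * PI >= 6]. So the indices of the rows met
    by [A] differ by at most [(d + 2) / 6], and there are at most [d + 2] of them. *)
Lemma mass_rows r d A n B : R0 <= r -> 0 <= d -> Small A r d -> 0 <= B ->
  (forall j, (j < nrows r)%nat ->
    rsum (fun i => mass n (X r + INR i) (fun w => A (Ebranch lam j w))) (ncols r) <= B) ->
  mass (S n) r A <= (d + 2) * B / (INR (nrows r) * INR (ncols r)).
Proof.
  intros Hr Hd HA HB H. simpl. unfold Rdiv. rewrite Rmult_comm.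
  apply Rmult_le_compat_r; [left; now apply avg_pos|].
  apply Rle_trans with (((d + 2) / 6 + 1) * B); [|apply Rmult_le_compat_r; lra].
  set (f := fun j => rsum _ _).
  assert (Hne : forall j, (j < nrows r)%nat -> f j <> 0 ->
     exists i w, (i < ncols r)%nat /\ Box (X r + INR i) w /\ A (Ebranch lam j w)).
  { intros j Hj Hf. destruct (excluded_middle_informative
     (exists i w, (i < ncols r)%nat /\ Box (X r + INR i) w /\ A (Ebranch lam j w))) as [|N]; auto.
    destruct Hf. unfold f. rewrite <- (Rmult_0_r (INR (ncols r))), <- rsum_const.
    apply rsum_ext; intros i Hi. apply mass_disjoint; [now apply child_ge|].
    intros w Hw HAw. apply N. exists i, w; auto. }
  apply rsum_window; auto; [lra | |].
  - intros j Hj; split; [|now apply H].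
    apply rsum_nonneg; intros; apply mass_nonneg; now apply child_ge.
  - intros j j' Hj Hj' Hf Hf'.
    destruct (Hne j Hj Hf) as [i [w [Hi [Hw HAw]]]].
    destruct (Hne j' Hj' Hf') as [i' [w' [Hi' [Hw' HAw']]]].
    destruct (HA _ _ HAw HAw' (Ebranch_Box r i j w Hr Hi Hj Hw) (Ebranch_Box r i' j' w' Hr Hi' Hj' Hw')) as [_ Hc].
    assert (H1 := Ebranch_snd r i j w Hr Hw). assert (H2 := Ebranch_snd r i' j' w' Hr Hw').
    revert Hc H1 H2. generalize (snd (Ebranch lam j w)) (snd (Ebranch lam j' w')). intros u v Hc H1 H2.
    assert (v - u <= d) by (unfold Rabs in Hc; destruct (Rcase_abs (u - v)); lra).
    assert (u - 2 * INR j * PI <= 1) by (unfold Rabs in H1; destruct (Rcase_abs (u - 2 * INR j * PI)); lra).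
    assert (-1 <= v - 2 * INR j' * PI) by (unfold Rabs in H2; destruct (Rcase_abs (v - 2 * INR j' * PI)); lra).
    assert (HPI := PI2_3_2).
    destruct (Rle_dec (INR j' - INR j) 0); [lra|].
    assert (6 * (INR j' - INR j) <= 2 * PI * (INR j' - INR j)) by (apply Rmult_le_compat_r; lra).
    lra.
Qed.

(** Every column of a row that is met is charged in full. This suffices for [d >= 1]. *)
Lemma mass_crude r d A n : R0 <= r -> 0 <= d -> Small A r d ->
  mass (S n) r A <= (d + 2) / INR (nrows r).
Proof.
  intros Hr Hd HA. destruct (nrows_spec r Hr), (ncols_spec r Hr).
  replace ((d + 2) / INR (nrows r)) with ((d + 2) * INR (ncols r) / (INR (nrows r) * INR (ncols r)))
    by (field; lra).
  apply mass_rows; auto; [lra|]. intros j Hj.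
  apply Rle_trans with (rsum (fun _ => 1) (ncols r)); [|rewrite rsum_const; lra].
  apply rsum_le; intros; apply mass_le1; now apply child_ge.
Qed.

(** The part of [A] in one row, magnified by [E], has real parts in an interval of length
    [6 * X r * d], which touches at most [6 * X r * d + 2] columns of unit width. *)
Lemma mass_zoom r d A n B : R0 <= r -> 0 <= d -> Small A r d -> 0 <= B ->
  (forall i A', Small A' (X r + INR i) (6 * X r * d) -> mass n (X r + INR i) A' <= B) ->
  mass (S n) r A <= (d + 2) * ((6 * X r * d + 2) * B) / (INR (nrows r) * INR (ncols r)).
Proof.
  intros Hr Hd HA HB H. destruct (rad_ge r Hr) as [_ HX].
  apply mass_rows; auto.
  { apply Rmult_le_pos; auto. nra. }
  intros j Hj. replace (6 * X r * d + 2) with ((6 * X r * d + 1) + 1) by ring.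
  set (f := fun i => mass _ _ _).
  assert (Hne : forall i, (i < ncols r)%nat -> f i <> 0 ->
     exists w, Box (X r + INR i) w /\ A (Ebranch lam j w)).
  { intros i Hi Hf. destruct (excluded_middle_informative
     (exists w, Box (X r + INR i) w /\ A (Ebranch lam j w))) as [|N]; auto.
    destruct Hf. apply mass_disjoint; [now apply child_ge|].
    intros w Hw HAw. apply N. exists w; auto. }
  apply rsum_window; auto; [nra | |].
  - intros i Hi; split; [apply mass_nonneg; now apply child_ge|]. apply H.
    intros w w' HAw HAw' Hw Hw'. eapply child_close with (i := i) (i' := i); eauto.
  - intros i i' Hi Hi' Hf Hf'.
    destruct (Hne i Hi Hf) as [w [Hw HAw]]. destruct (Hne i' Hi' Hf') as [w' [Hw' HAw']].
    destruct (child_close r d A i i' j w w') as [Hc _]; auto.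
    destruct Hw as [Hw _], Hw' as [Hw' _].
    assert (fst w' - fst w <= 6 * X r * d) by (unfold Rabs in Hc; destruct (Rcase_abs (fst w - fst w')); lra).
    lra.
Qed.

(** For [d < 1] at most 3 rows and [8 * X r * d] columns are met. Here 1224 is 3 * 8, times 3 and 17
    for the rounding in [ncols] and [nrows]. *)
Lemma mass_large r d A n : R0 <= r -> / X r <= d -> Small A r d ->
  mass (S n) r A <= 1224 * d / psi r.
Proof.
  intros Hr Hd HA. destruct (nrows_spec r Hr) as [HN HN'], (ncols_spec r Hr) as [HK HK'].
  destruct (rad_ge r Hr) as [_ HX].
  assert (H0 : 0 < / X r) by (apply Rinv_0_lt_compat; lra).
  assert (HXd : 1 <= X r * d).
  { rewrite <- (Rinv_r (X r)) by lra. apply Rmult_le_compat_l; lra. }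
  assert (Hfin : 72 * d / INR (nrows r) <= 1224 * d / psi r).
  { apply Rmult_le_reg_r with (psi r * INR (nrows r)); [nra|].
    replace (72 * d / INR (nrows r) * (psi r * INR (nrows r))) with (72 * d * psi r) by (field; lra).
    replace (1224 * d / psi r * (psi r * INR (nrows r))) with (72 * d * (17 * INR (nrows r))) by (field; lra).
    apply Rmult_le_compat_l; lra. }
  eapply Rle_trans; [|apply Hfin].
  apply Rle_trans with (mass 1 r A); [apply mass_le; auto; lia|].
  destruct (Rle_dec 1 d).
  - eapply Rle_trans; [apply mass_crude; eauto; lra|].
    apply Rmult_le_compat_r; [left; apply Rinv_0_lt_compat; lra | lra].
  - eapply Rle_trans; [apply mass_zoom with (B := 1); eauto; try lra|].
    { intros; apply mass_le1; now apply child_ge. }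
    apply Rmult_le_reg_r with (INR (nrows r) * INR (ncols r)); [nra|].
    replace (72 * d / INR (nrows r) * (INR (nrows r) * INR (ncols r)))
      with (24 * d * (3 * INR (ncols r))) by (field; lra).
    unfold Rdiv; rewrite Rmult_assoc, Rinv_l, Rmult_1_r by nra.
    assert (24 * d * X r <= 24 * d * (3 * INR (ncols r))) by (apply Rmult_le_compat_l; lra).
    assert ((d + 2) * ((6 * X r * d + 2) * 1) <= 3 * (8 * (X r * d))).
    { apply Rmult_le_compat; nra. }
    lra.
Qed.

(* [mass n] decreases in [n], so this says that the masses in the limit [n -> oo] add up to
   at most [s]. *)
Definition light (r : R) (U : nat -> C -> Prop) (s : R) : Prop :=
  R0 <= r /\ forall K, exists n, rsum (fun k => mass n r (U k)) K <= s.

(** Pigeonhole. If every child were heavy, monotonicity in [K] would give one [K] for the finitely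
    many children; averaging then makes the first [K] masses at generation [S n] exceed [s] for
    every [n], although they are at most those at generation [n]. *)
Lemma light_child r U s : light r U s ->
  exists i j, (i < ncols r)%nat /\ (j < nrows r)%nat /\
    light (X r + INR i) (fun k w => U k (Ebranch lam j w)) s.
Proof.
  intros [Hr HU]. destruct (nrows_spec r Hr) as [HN _], (ncols_spec r Hr) as [HK _].
  apply NNPP; intros Hno.
  set (heavy := fun j i K => forall n,
    s < rsum (fun k => mass n (X r + INR i) (fun w => U k (Ebranch lam j w))) K).
  assert (Hmono : forall j i K K', (K <= K')%nat -> heavy j i K -> heavy j i K').
  { intros j i K K' HKK H n. eapply Rlt_le_trans; [apply H|]. apply rsum_incr; auto.
    intros; apply mass_nonneg; now apply child_ge. }
  destruct (bounded_choice (fun j K => forall i, (i < ncols r)%nat -> heavy j i K) (nrows r)) as [K HKall].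
  { intros j K K' HKK H i Hi. apply Hmono with K; auto. }
  { intros j Hj. apply (bounded_choice (heavy j)); [apply Hmono|].
    intros i Hi. apply NNPP; intros Hn. apply Hno. exists i, j; repeat split; auto.
    - now apply child_ge.
    - intros K. apply NNPP; intros Hn'. apply Hn. exists K. intros n.
      apply Rnot_le_lt. intros Hle. apply Hn'. exists n; auto. }
  destruct (HU K) as [n Hn].
  assert (Hlt : s < rsum (fun k => mass (S n) r (U k)) K); cycle 1.
  { assert (rsum (fun k => mass (S n) r (U k)) K <= rsum (fun k => mass n r (U k)) K); [|lra].
    apply rsum_le; intros; now apply mass_succ_le. }
  simpl. rewrite rsum_scal, rsum_exchange, <- (avg_const s r Hr).
  apply Rmult_lt_compat_l; [now apply avg_pos|].
  apply rsum_lt; [apply INR_lt; simpl; lra|]. intros j Hj. rewrite rsum_exchange.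
  apply rsum_lt; [apply INR_lt; simpl; lra|]. intros i Hi. now apply HKall.
Qed.

Lemma light_walk r U s : light r U s ->
  exists (i j : nat -> nat) (r_ : nat -> R) (U_ : nat -> nat -> C -> Prop),
    r_ 0%nat = r /\ U_ 0%nat = U /\ forall m, light (r_ m) (U_ m) s /\
      (i m < ncols (r_ m))%nat /\ (j m < nrows (r_ m))%nat /\
      r_ (S m) = X (r_ m) + INR (i m) /\ U_ (S m) = fun k w => U_ m k (Ebranch lam (j m) w).
Proof.
  intros Hl.
  assert (Hstep : forall st : R * (nat -> C -> Prop), exists ij : nat * nat,
    light (fst st) (snd st) s ->
    (fst ij < ncols (fst st))%nat /\ (snd ij < nrows (fst st))%nat /\
    light (X (fst st) + INR (fst ij)) (fun k w => snd st k (Ebranch lam (snd ij) w)) s).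
  { intros st. destruct (classic (light (fst st) (snd st) s)) as [H|H].
    - destruct (light_child _ _ _ H) as [i [j Hij]]. exists (i, j); auto.
    (* A default for nodes that are not light makes the choice function total. *)
    - exists (0, 0)%nat; contradiction. }
  set (pick := fun st => proj1_sig (constructive_indefinite_description _ (Hstep st))).
  assert (Hpick : forall st, light (fst st) (snd st) s ->
    (fst (pick st) < ncols (fst st))%nat /\ (snd (pick st) < nrows (fst st))%nat /\
    light (X (fst st) + INR (fst (pick st))) (fun k w => snd st k (Ebranch lam (snd (pick st)) w)) s).
  { intros st. exact (proj2_sig (constructive_indefinite_description _ (Hstep st))). }
  set (next := fun st : R * (nat -> C -> Prop) => (X (fst st) + INR (fst (pick st)),
    fun k w => snd st k (Ebranch lam (snd (pick st)) w))).
  set (st := fun m => Nat.iter m next (r, U)).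
  exists (fun m => fst (pick (st m))), (fun m => snd (pick (st m))),
    (fun m => fst (st m)), (fun m => snd (st m)).
  split; [reflexivity|]. split; [reflexivity|].
  assert (Hall : forall m, light (fst (st m)) (snd (st m)) s).
  { induction m as [|m IH]; [exact Hl|]. apply (Hpick (st m) IH). }
  intros m. destruct (Hpick (st m) (Hall m)) as [H1 [H2 _]]. repeat split; auto; apply Hall.
Qed.

(** * Limit points of infinite branches *)

Section Orbit.
Context (i j : nat -> nat) (r_ : nat -> R)
  (r_ge : forall m, R0 <= r_ m)
  (i_lt : forall m, (i m < ncols (r_ m))%nat) (j_lt : forall m, (j m < nrows (r_ m))%nat)
  (r_succ : forall m, r_ (S m) = X (r_ m) + INR (i m)).

Fixpoint pull (m k : nat) (w : C) : C :=
  match k with O => w | S k' => Ebranch lam (j m) (pull (S m) k' w) end.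

Lemma pull_Box k : forall m w, Box (r_ (m + k)) w -> Box (r_ m) (pull m k w).
Proof.
  induction k as [|k IH]; intros m w Hw; simpl.
  - now rewrite Nat.add_0_r in Hw.
  - apply Ebranch_Box with (i m); auto. rewrite <- r_succ. apply IH.
    now rewrite Nat.add_succ_comm.
Qed.

Lemma Emap_pull m k w : Box (r_ (m + S k)) w -> Emap lam (pull m (S k) w) = pull (S m) k w.
Proof.
  intros Hw. simpl. apply Emap_Ebranch; auto.
  assert (H : Box (r_ (S m)) (pull (S m) k w)) by (apply pull_Box; now rewrite Nat.add_succ_comm).
  rewrite r_succ in H. now destruct (Box_sector _ _ _ (r_ge m) H).
Qed.

Lemma Eiter_pull n : forall m k w, Box (r_ (m + (n + k))) w ->
  Eiter lam n (pull m (n + k) w) = pull (m + n) k w.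
Proof.
  induction n as [|n IH]; intros m k w Hw.
  - now rewrite Nat.add_0_r.
  - rewrite <- Eiter_Emap. simpl Nat.add. rewrite Emap_pull; [|exact Hw].
    rewrite IH; [f_equal; lia|].
    now replace (S m + (n + k))%nat with (m + (S n + k))%nat by lia.
Qed.

Lemma pull_add a : forall m b w, pull m (a + b) w = pull m a (pull (m + a) b w).
Proof.
  induction a as [|a IH]; intros m b w; simpl.
  - now rewrite Nat.add_0_r.
  - rewrite IH. do 3 f_equal. lia.
Qed.

(** A box is too tall for [Emap_expand]. The first pull-back only brings it into a piece of width 1
    and height at most 2, of diameter at most 4; after that [E] stretches by at least 12 / 2, more
    than the factor 2 that is recorded. *)
Lemma pull_contract k : forall m w w', Box (r_ (m + S k)) w -> Box (r_ (m + S k)) w' ->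
  cdist (pull m (S k) w) (pull m (S k) w') <= 4 * (/ 2) ^ k.
Proof.
  assert (Hband : forall m k w w', Box (r_ (m + S k)) w -> Box (r_ (m + S k)) w' ->
    Rabs (snd (pull m (S k) w) - snd (pull m (S k) w')) <= 2).
  { intros m k' w w' Hw Hw'.
    rewrite <- Nat.add_succ_comm in Hw, Hw'.
    apply pull_Box in Hw, Hw'. rewrite r_succ in Hw, Hw'.
    assert (H1 := Ebranch_snd _ _ (j m) _ (r_ge m) Hw).
    assert (H2 := Ebranch_snd _ _ (j m) _ (r_ge m) Hw').
    replace (snd (pull m (S k') w) - snd (pull m (S k') w')) with
      ((snd (pull m (S k') w) - 2 * INR (j m) * PI) - (snd (pull m (S k') w') - 2 * INR (j m) * PI)) by ring.
    eapply Rle_trans; [apply Rabs_triang|]. rewrite Rabs_Ropp. simpl pull. lra. }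
  induction k as [|k IH]; intros m w w' Hw Hw'.
  - replace (4 * (/ 2) ^ 0) with (2 * 2) by (simpl; ring). apply cdist_le. split; auto.
    apply pull_Box in Hw, Hw'. destruct Hw as [Hw _], Hw' as [Hw' _].
    apply Rabs_le; lra.
  - assert (HE := Emap_expand lam 12 (pull m (S (S k)) w) (pull m (S (S k)) w')).
    rewrite !Emap_pull in HE by auto.
    assert (HX : forall v, Box (r_ (m + S (S k))) v -> 12 <= lam * exp (fst (pull m (S (S k)) v))).
    { intros v Hv. destruct (rad_ge _ (r_ge m)) as [_ H12].
      apply Rle_trans with (X (r_ m)); auto. apply rad_le; auto. now apply pull_Box. }
    specialize (HE ltac:(lra) (HX w Hw) (HX w' Hw') (Hband _ _ _ _ Hw Hw')).
    rewrite <- Nat.add_succ_comm in Hw, Hw'. specialize (IH _ _ _ Hw Hw').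
    simpl pow. assert (H0 := cdist_pos (pull m (S (S k)) w) (pull m (S (S k)) w')). lra.
Qed.

(** The pulled-back reference points form a Cauchy sequence, and boxes are closed, so every iterate
    of the limit stays in its box. The second clause puts whole pieces of the tree near [z], which
    is needed to reach a full mass. *)
Lemma orbit_point : exists z, (forall m, Box (r_ m) (Eiter lam m z)) /\
  forall N w, Box (r_ (S N)) w -> close (4 * (/ 2) ^ N) z (pull 0 (S N) w).
Proof.
  set (c := fun n => (r_ n, 0) : C).
  assert (Hc : forall n, Box (r_ n) (c n)).
  { intros n; split; simpl; [lra|]. rewrite Rabs_R0. assert (H := psi_big _ (r_ge n)). lra. }
  set (u := fun n => pull 0 (S n) (c (S n))).
  assert (Hclose : forall N n w, (N <= n)%nat -> Box (r_ (S N)) w ->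
    close (4 * (/ 2) ^ N) (u n) (pull 0 (S N) w)).
  { intros N n w Hn Hw. unfold u. replace (pull 0 (S n)) with (pull 0 (S N + (n - N))) by (f_equal; lia).
    rewrite pull_add. assert (Hb : Box (r_ (0 + S N)) (pull (0 + S N) (n - N) (c (S n)))).
    { apply pull_Box. replace (0 + S N + (n - N))%nat with (S n) by lia. apply Hc. }
    assert (H := pull_contract N 0 _ _ Hb Hw).
    destruct (close_cdist (pull 0 (S N) (pull (0 + S N) (n - N) (c (S n)))) (pull 0 (S N) w)).
    split; lra. }
  (* Two terms are compared through the reference point of generation [S N], which doubles the 4 of
     [pull_contract]. *)
  destruct (Ccv_complete u (fun N => 8 * (/ 2) ^ N)) as [z Hz].
  { intros e He. destruct (pow_lt_1_zero (/ 2)) with (y := e / 8) as [N HN].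
    - rewrite Rabs_right; lra.
    - lra.
    - exists N. specialize (HN N (le_n N)).
      rewrite Rabs_right in HN by (left; apply pow_lt; lra). lra. }
  { intros N n n' Hn Hn'.
    destruct (Hclose N n (c (S N)) Hn (Hc _)) as [H1 H2].
    destruct (Hclose N n' (c (S N)) Hn' (Hc _)) as [H3 H4].
    rewrite Rabs_minus_sym in H3, H4. split.
    - replace (fst (u n) - fst (u n')) with ((fst (u n) - fst (pull 0 (S N) (c (S N)))) + (fst (pull 0 (S N) (c (S N))) - fst (u n'))) by ring.
      eapply Rle_trans; [apply Rabs_triang|]. lra.
    - replace (snd (u n) - snd (u n')) with ((snd (u n) - snd (pull 0 (S N) (c (S N)))) + (snd (pull 0 (S N) (c (S N))) - snd (u n'))) by ring.
      eapply Rle_trans; [apply Rabs_triang|]. lra. }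
  exists z; split.
  - intros m. destruct (Ccv_Eiter lam m u z Hz) as [H1 H2].
    assert (HB : forall n, (m <= n)%nat -> Box (r_ m) (Eiter lam m (u n))).
    { intros n Hn. unfold u. replace (pull 0 (S n)) with (pull 0 (m + (S n - m))) by (f_equal; lia).
      rewrite Eiter_pull.
      - apply pull_Box. replace (0 + m + (S n - m))%nat with (S n) by lia. apply Hc.
      - replace (0 + (m + (S n - m)))%nat with (S n) by lia. apply Hc. }
    repeat split.
    + assert (- fst (Eiter lam m z) <= - r_ m); [|lra].
      apply (Un_cv_le_bound _ _ _ m (CV_opp _ _ H1)).
      intros n Hn; unfold opp_seq. destruct (HB n Hn) as [Hb _]; lra.
    + apply (Un_cv_le_bound _ _ _ m H1). intros n Hn. destruct (HB n Hn) as [Hb _]; lra.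
    + replace (snd (Eiter lam m z)) with (snd (Eiter lam m z) - 0) by ring.
      apply (Un_cv_abs_bound _ _ _ _ m H2). intros n Hn. rewrite Rminus_0_r. apply (HB n Hn).
  - intros N w Hw. destruct Hz as [H1 H2]. split.
    + apply (Un_cv_abs_bound _ _ _ _ N H1). intros n Hn. now apply Hclose.
    + apply (Un_cv_abs_bound _ _ _ _ N H2). intros n Hn. now apply Hclose.
Qed.
End Orbit.

(* A family [U] of total mass less than one misses a point of the limit set, except
   possibly for points at the boundary of the [U k]. *)
Lemma light_point r U s : light r U s -> s < 1 ->
  exists (r_ : nat -> R) z, r_ 0%nat = r /\ (forall m, R0 <= r_ m /\ X (r_ m) <= r_ (S m)) /\
    (forall m, Box (r_ m) (Eiter lam m z)) /\
    forall k e, 0 < e -> exists w, close e z w /\ ~ U k w.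
Proof.
  intros Hl Hs. destruct (light_walk _ _ _ Hl) as [i [j [r_ [U_ [Hr0 [HU0 Hm]]]]]].
  destruct (orbit_point i j r_) as [z [Hz1 Hz2]]; try (intros m; apply (Hm m)).
  exists r_, z. split; [exact Hr0|]. split; [|split; [exact Hz1|]].
  { intros m. destruct (Hm m) as [[H0 _] [_ [_ [H1 _]]]]. split; auto.
    rewrite H1. assert (H2 := pos_INR (i m)); lra. }
  intros k e He. apply NNPP; intros Hno.
  destruct (pow_lt_1_zero (/ 2)) with (y := e / 4) as [N HN].
  { rewrite Rabs_right; lra. }
  { lra. }
  specialize (HN N (le_n N)). rewrite Rabs_right in HN by (left; apply pow_lt; lra).
  assert (HU : forall n m k w, U_ m k (pull j m n w) <-> U_ (m + n)%nat k w).
  { induction n as [|n IH]; intros m k' w; simpl.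
    - now rewrite Nat.add_0_r.
    - rewrite <- Nat.add_succ_comm, <- IH.
      destruct (Hm m) as [_ [_ [_ [_ ->]]]]. reflexivity. }
  destruct (Hm (S N)) as [[Hr HK] _]. destruct (HK (S k)) as [n Hn].
  (* If [U k] contained a neighbourhood of [z], it would contain the whole piece of generation [S N]
     around [z], and that single set would have mass one. *)
  assert (Hfull : mass n (r_ (S N)) (U_ (S N) k) = 1).
  { apply mass_full; auto. intros w Hw. apply (HU (S N) 0%nat). apply NNPP; intros HnU.
    apply Hno. exists (pull j 0 (S N) w). split; [|now rewrite <- HU0].
    destruct (Hz2 N w Hw). split; lra. }
  assert (H1 := rsum_term_le (fun k => mass n (r_ (S N)) (U_ (S N) k)) (S k) k).
  simpl in H1. rewrite Hfull in H1. simpl in Hn.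
  specialize (H1 (fun i => mass_nonneg n _ _ Hr) (Nat.lt_succ_diag_r k)). lra.
Qed.

(** * Mass estimates against the gauge *)

Context (p : R -> R) (t0 delta : R) (t0_pos : 0 < t0) (delta_pos : 0 < delta)
  (p_pos : forall x, x > / t0 -> p x > 0)
  (p_incr : forall x y, / t0 < x <= y -> p x <= p y)
  (tp_incr : forall s t, 0 < s <= t -> t < t0 -> s * p (/ s) <= t * p (/ t))
  (psi_t0 : forall x, R0 <= x -> psi x < t0 * x)
  (p_growth : forall r, R0 <= r ->
     p (X r * Rpower (ln (X r)) (1 + delta) / psi (X r)) <= psi r)
  (ln_rad_ge1 : forall r, R0 <= r -> 1 <= ln (X r))
  (scale_step : forall r s, R0 <= r -> X r <= s ->
     6 * X r * Rpower (ln (X r)) (1 + delta) <= Rpower (ln (X s)) (1 + delta)).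

(** 1224 comes from [mass_large] at the children; 7344 is 24 * 6 * 51, the loss of the magnification
    that leads to them, with 51 = 3 * 17 from rounding. *)
Definition mass_const : R := 1224 * 7344.

(* [s] is the factor by which the set has been magnified so far, so that [s / d] is the
   reciprocal of its original diameter. *)
Definition mass_bound (k : nat) : Prop := forall r s A d n,
  R0 <= r -> 1 <= s <= Rpower (ln (X r)) (1 + delta) -> / 2 ^ k <= d -> / t0 < s / d ->
  Small A r d -> (k + 2 <= n)%nat -> mass n r A <= mass_const * d / p (s / d).

(** The threshold [psi (X r) / X r] is where the image under [E] becomes as large as the height of
    the strip there. Above it [mass_large] at [r] suffices; below it the set is magnified once and
    [mass_large] is applied at the children. *)
Lemma mass_bound_large r s A d n :
  R0 <= r -> 1 <= s <= Rpower (ln (X r)) (1 + delta) -> / X r <= d -> / t0 < s / d ->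
  Small A r d -> (2 <= n)%nat -> mass n r A <= mass_const * d / p (s / d).
Proof.
  intros Hr Hs Hd Hsd HA Hn. destruct n as [|n]; [lia|]. unfold mass_const.
  destruct (rad_ge r Hr) as [HX0 HX]. assert (Hpsi := psi_big r Hr).
  assert (HpX := psi_big (X r) HX0). assert (HpX' := psi_small (X r) HX0). assert (HpX'' := psi_t0 (X r) HX0).
  assert (Hpp := p_pos _ Hsd).
  assert (H0 : 0 < / X r) by (apply Rinv_0_lt_compat; lra).
  assert (HXd : 1 <= X r * d).
  { rewrite <- (Rinv_r (X r)) by lra. apply Rmult_le_compat_l; lra. }
  assert (Hd0 : 0 < d) by lra.
  (* The growth hypothesis at [t = X r]; the power of the logarithm absorbs [s]. *)
  assert (Hc : p (s * X r / psi (X r)) <= psi r).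
  { eapply Rle_trans; [|apply p_growth; auto]. apply p_incr.
    assert (H1 : s * X r / psi (X r) <= X r * Rpower (ln (X r)) (1 + delta) / psi (X r)).
    { apply Rmult_le_compat_r; [left; apply Rinv_0_lt_compat; lra|]. nra. }
    split; auto. apply Rlt_le_trans with (X r / psi (X r)).
    - apply Rmult_lt_reg_r with (t0 * psi (X r)); [nra|]. field_simplify; lra.
    - apply Rmult_le_compat_r; [left; apply Rinv_0_lt_compat; lra|]. nra. }
  destruct (Rle_dec (psi (X r) / X r) d) as [Hbig|Hbig].
  - assert (Hp : p (s / d) <= psi r).
    { eapply Rle_trans; [|apply Hc]. apply p_incr; split; auto.
      apply Rmult_le_reg_r with (d * psi (X r) / s).
      - apply Rdiv_lt_0_compat; nra.
      - replace (s / d * (d * psi (X r) / s)) with (psi (X r)) by (field; lra).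
        replace (s * X r / psi (X r) * (d * psi (X r) / s)) with (d * X r) by (field; lra).
        replace (psi (X r)) with (psi (X r) / X r * X r) by (field; lra).
        apply Rmult_le_compat_r; lra. }
    eapply Rle_trans; [apply mass_large; eauto|].
    apply Rle_trans with (1224 * d / p (s / d)).
    + apply Rmult_le_compat_l; [lra|]. apply Rinv_le_contravar; lra.
    + apply Rmult_le_compat_r; [left; apply Rinv_0_lt_compat; lra | lra].
  - apply Rnot_le_lt in Hbig. destruct n as [|n]; [lia|].
    destruct (nrows_spec r Hr) as [HN HN'], (ncols_spec r Hr) as [HK HK'].
    assert (HdX : X r * d < psi (X r)).
    { replace (psi (X r)) with (X r * (psi (X r) / X r)) by (field; lra). apply Rmult_lt_compat_l; lra. }
    assert (Hd1 : d < 1) by nra.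
    set (B := 1224 * (6 * X r * d) / psi (X r)).
    assert (HB : 0 <= B) by (unfold B, Rdiv; apply Rmult_le_pos; [nra | left; apply Rinv_0_lt_compat; lra]).
    eapply Rle_trans; [apply (mass_zoom r d A _ B); [auto | lra | auto | auto |]|].
    { intros i A' HA'. assert (Hr' := child_ge r i Hr). assert (Hi0 := pos_INR i).
      assert (Hpi : psi (X r) <= psi (X r + INR i)) by (apply psi_incr; lra).
      eapply Rle_trans; [apply mass_large; [auto | | apply HA']|].
      - apply Rle_trans with 1; [|lra]. destruct (rad_ge _ Hr').
        rewrite <- Rinv_1. apply Rinv_le_contravar; lra.
      - apply Rmult_le_compat_l; [nra|]. apply Rinv_le_contravar; lra. }
    (* Monotonicity of [t * p (/ t)] lets the factor [X r * d / psi (X r)], which is below one, pay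
       for lowering the argument of [p] to [s * X r / psi (X r)]. *)
    assert (Hkey : X r * d / psi (X r) * p (s / d) <= psi r).
    { apply Rle_trans with (p (s * X r / psi (X r))); auto.
      assert (Hq : 0 < psi (X r) / (X r * s)) by (apply Rdiv_lt_0_compat; nra).
      assert (H1 := tp_incr (d / s) (psi (X r) / (X r * s))).
      replace (/ (d / s)) with (s / d) in H1 by (field; lra).
      replace (/ (psi (X r) / (X r * s))) with (s * X r / psi (X r)) in H1 by (field; lra).
      apply Rmult_le_reg_l with (psi (X r) / (X r * s)); auto.
      replace (psi (X r) / (X r * s) * (X r * d / psi (X r) * p (s / d))) with (d / s * p (s / d)) by (field; lra).
      apply H1.
      - split; [apply Rdiv_lt_0_compat; lra|].
        apply Rmult_le_reg_r with s; [lra|]. replace (d / s * s) with d by (field; lra).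
        replace (psi (X r) / (X r * s) * s) with (psi (X r) / X r) by (field; lra). lra.
      - apply Rmult_lt_reg_r with (X r * s); [nra|].
        replace (psi (X r) / (X r * s) * (X r * s)) with (psi (X r)) by (field; lra).
        apply Rlt_le_trans with (t0 * X r); [lra|]. assert (X r <= X r * s) by nra. nra. }
    assert (Hn1 : (d + 2) * ((6 * X r * d + 2) * B) <= 24 * (X r * d) * B).
    { replace (24 * (X r * d) * B) with (3 * (8 * (X r * d) * B)) by ring.
      apply Rmult_le_compat; try lra; [|apply Rmult_le_compat_r; lra].
      apply Rmult_le_pos; auto; lra. }
    assert (HNK : 0 < INR (nrows r) * INR (ncols r)) by (apply Rmult_lt_0_compat; lra).
    assert (HXp : 0 < X r * psi r) by (apply Rmult_lt_0_compat; lra).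
    assert (Hden : X r * psi r <= 51 * (INR (nrows r) * INR (ncols r))).
    { replace (51 * (INR (nrows r) * INR (ncols r))) with (3 * INR (ncols r) * (17 * INR (nrows r))) by ring.
      apply Rmult_le_compat; lra. }
    apply Rle_trans with (24 * (X r * d) * B * (51 / (X r * psi r))).
    + unfold Rdiv. apply Rmult_le_compat; auto.
      * apply Rmult_le_pos; [lra|]. apply Rmult_le_pos; auto; lra.
      * left; now apply Rinv_0_lt_compat.
      * apply Rmult_le_reg_r with (INR (nrows r) * INR (ncols r) * (X r * psi r)); [now apply Rmult_lt_0_compat|].
        replace (51 * / (X r * psi r) * (INR (nrows r) * INR (ncols r) * (X r * psi r)))
          with (51 * (INR (nrows r) * INR (ncols r))) by (field; lra).
        replace (/ (INR (nrows r) * INR (ncols r)) * (INR (nrows r) * INR (ncols r) * (X r * psi r)))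
          with (X r * psi r) by (field; lra). auto.
    + unfold B. apply Rmult_le_reg_r with (p (s / d) * psi r); [apply Rmult_lt_0_compat; lra|].
      replace (24 * (X r * d) * (1224 * (6 * X r * d) / psi (X r)) * (51 / (X r * psi r)) * (p (s / d) * psi r))
        with (1224 * 7344 * d * (X r * d / psi (X r) * p (s / d))) by (field; lra).
      replace (1224 * 7344 * d / p (s / d) * (p (s / d) * psi r)) with (1224 * 7344 * d * psi r) by (field; lra).
      apply Rmult_le_compat_l; lra.
Qed.

(** Magnification multiplies [d] and [s] by [6 * X r]: the quotient [s / d] is unchanged, the new
    [d] is large enough for [k], and [scale_step] keeps the new [s] admissible. Since [X r * d < 1],
    at most 3 rows and 8 columns are met. *)
Lemma mass_bound_zoom k : mass_bound k -> forall r s A d n,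
  R0 <= r -> 1 <= s <= Rpower (ln (X r)) (1 + delta) -> / 2 ^ S k <= d -> d < / X r ->
  / t0 < s / d -> Small A r d -> (S k + 2 <= n)%nat ->
  mass n r A <= 432 / INR (nrows r) * (mass_const * d / p (s / d)).
Proof.
  intros IH r s A d n Hr Hs Hkd Hd Hsd HA Hn. destruct n as [|n]; [lia|].
  destruct (rad_ge r Hr) as [HX0 HX].
  destruct (nrows_spec r Hr) as [HN HN'], (ncols_spec r Hr) as [HK HK'].
  assert (Hpp := p_pos _ Hsd).
  assert (Hpow : 0 < 2 ^ k) by (apply pow_lt; lra).
  assert (H2 : / 2 ^ S k = / 2 * / 2 ^ k) by (simpl; field; lra).
  assert (H3 : 0 < / 2 ^ k) by now apply Rinv_0_lt_compat.
  assert (Hd0 : 0 < d) by lra.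
  assert (HXd : X r * d < 1).
  { rewrite <- (Rinv_r (X r)) by lra. apply Rmult_lt_compat_l; lra. }
  assert (Hd1 : d < 1) by nra.
  assert (Hm0 : 0 < mass_const) by (unfold mass_const; lra).
  set (B := mass_const * (6 * X r * d) / p (s / d)).
  assert (HXd0 : 0 < X r * d) by (apply Rmult_lt_0_compat; lra).
  assert (HB : 0 <= B).
  { unfold B, Rdiv. apply Rmult_le_pos; [apply Rmult_le_pos; lra | left; apply Rinv_0_lt_compat; lra]. }
  eapply Rle_trans; [apply (mass_zoom r d A _ B); [auto | lra | auto | auto |]|].
  { intros i A' HA'. assert (Hr' := child_ge r i Hr). assert (Hi0 := pos_INR i).
    assert (E : s / d = (6 * X r * s) / (6 * X r * d)) by (field; lra).
    unfold B; rewrite E. apply IH; auto.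
    - split; [nra|]. eapply Rle_trans; [|apply scale_step with (r := r); auto; lra].
      apply Rmult_le_compat_l; lra.
    - nra.
    - now rewrite <- E.
    - lia. }
  assert (Hden : X r <= 3 * INR (ncols r)) by lra.
  apply Rle_trans with (24 * B / (INR (nrows r) * INR (ncols r))).
  - apply Rmult_le_compat_r; [left; apply Rinv_0_lt_compat; nra|].
    replace (24 * B) with (3 * (8 * B)) by ring.
    apply Rmult_le_compat; try lra; [|apply Rmult_le_compat_r; lra].
    apply Rmult_le_pos; auto; nra.
  - unfold B. apply Rmult_le_reg_r with (p (s / d) * (INR (nrows r) * INR (ncols r))).
    { apply Rmult_lt_0_compat; nra. }
    replace (24 * (mass_const * (6 * X r * d) / p (s / d)) / (INR (nrows r) * INR (ncols r)) * (p (s / d) * (INR (nrows r) * INR (ncols r))))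
      with (144 * mass_const * d * X r) by (field; lra).
    replace (432 / INR (nrows r) * (mass_const * d / p (s / d)) * (p (s / d) * (INR (nrows r) * INR (ncols r))))
      with (144 * mass_const * d * (3 * INR (ncols r))) by (field; lra).
    apply Rmult_le_compat_l; nra.
Qed.

(** The constant does not grow with the number of magnifications, because [432 / INR (nrows r)] is
    at most one. *)
Lemma mass_bound_all k : mass_bound k.
Proof.
  induction k as [|k IH]; intros r s A d n Hr Hs Hkd Hsd HA Hn.
  - apply mass_bound_large; auto. destruct (rad_ge r Hr) as [HX0 HX].
    simpl in Hkd. assert (/ X r <= / 1) by (apply Rinv_le_contravar; lra). lra.
  - destruct (Rle_dec (/ X r) d) as [L|L].
    + apply mass_bound_large; auto; lia.
    + eapply Rle_trans; [apply (mass_bound_zoom k IH); eauto; lra|].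
      destruct (nrows_spec r Hr) as [HN _]. assert (Hpp := p_pos _ Hsd).
      assert (Hpow : 0 < / 2 ^ S k) by (apply Rinv_0_lt_compat, pow_lt; lra).
      assert (0 <= mass_const * d / p (s / d)).
      { unfold mass_const, Rdiv. apply Rmult_le_pos; [nra | left; apply Rinv_0_lt_compat; lra]. }
      assert (432 / INR (nrows r) <= 1).
      { apply Rmult_le_reg_r with (INR (nrows r)); [lra|]. field_simplify; lra. }
      nra.
Qed.

(** At the root, where [s = 1], the factor of one magnification is kept instead of being bounded by
    one. It becomes as small as desired when the root moves to the right. *)
Lemma mass_gauge r A d : R0 <= r -> 0 < d < / X r -> d < t0 -> Small A r d ->
  exists n0, forall n, (n0 <= n)%nat ->
    mass n r A <= 432 * mass_const / INR (nrows r) * (d / p (/ d)).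
Proof.
  intros Hr Hd Hdt HA.
  destruct (pow_lt_1_zero (/ 2)) with (y := d) as [k Hk].
  { rewrite Rabs_right; lra. }
  { lra. }
  specialize (Hk (S k) (le_S _ _ (le_n k))). rewrite pow_inv in Hk.
  assert (Hpow : 0 < / 2 ^ S k) by (apply Rinv_0_lt_compat, pow_lt; lra).
  rewrite Rabs_right in Hk by lra.
  exists (S k + 2)%nat; intros n Hn. destruct (nrows_spec r Hr) as [HN _].
  assert (Hsd : / t0 < 1 / d).
  { unfold Rdiv; rewrite Rmult_1_l. apply Rinv_lt_contravar; nra. }
  assert (Hpp := p_pos _ Hsd).
  replace (/ d) with (1 / d) by (field; lra).
  replace (432 * mass_const / INR (nrows r) * (d / p (1 / d)))
    with (432 / INR (nrows r) * (mass_const * d / p (1 / d))) by (field; lra).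
  apply (mass_bound_zoom k (mass_bound_all k)); auto; try lra.
  split; [lra|]. unfold Rpower. apply Rle_trans with (exp 0); [rewrite exp_0; lra|].
  apply exp_le_mono. apply Rmult_le_pos; [lra|]. rewrite <- ln_1. apply ln_le_mono; [lra|].
  now apply ln_rad_ge1.
Qed.

End MassOnTree.

(** * Infinite measure *)

Lemma linear_le_exp A c : 0 < c -> exists r0, forall r, r0 <= r -> A * r <= c * exp r.
Proof.
  intros Hc. exists (Rmax 0 (4 * A / c)). intros r Hr.
  assert (H0 := Rmax_l 0 (4 * A / c)). assert (H1 := Rmax_r 0 (4 * A / c)).
  assert (HA : 4 * A <= c * r).
  { replace (4 * A) with (c * (4 * A / c)) by (field; lra). apply Rmult_le_compat_l; lra. }
  assert (H2 := exp_ineq1_le (r / 2)).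
  assert (He : r / 2 * (r / 2) <= exp r).
  { replace r with (r / 2 + r / 2) at 3 by field. rewrite exp_plus. apply Rmult_le_compat; lra. }
  assert (c * (r / 2 * (r / 2)) <= c * exp r) by (apply Rmult_le_compat_l; lra). nra.
Qed.

Lemma le_rad lam : 0 < lam -> exists r0, forall r, r0 <= r -> r <= rad lam r.
Proof.
  intros Hl. destruct (linear_le_exp 1 lam Hl) as [r0 H]. exists r0; intros r Hr.
  specialize (H r Hr). unfold rad. lra.
Qed.

Lemma ln_le_linear e : 0 < e -> forall y, 0 < y -> ln y <= e * y - ln e.
Proof.
  intros He y Hy. assert (H := exp_ineq1_le (ln (e * y))).
  rewrite exp_ln in H by nra. rewrite ln_mult in H by auto. lra.
Qed.

(** As [ln (X s) >= X r / 2], it suffices, with [y = ln (X r)], that [ln 6 + y + (1 + delta) * ln y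
    <= (1 + delta) * (y - ln 2)]. The surplus [delta * y] is halved: [e] is chosen so that one half
    pays for [ln y], and the other pays for the constants in [A]. *)
Lemma Rpower_scale_step lam delta : 0 < lam -> 0 < delta ->
  exists r0, forall r s, r0 <= r -> rad lam r <= s ->
    6 * rad lam r * Rpower (ln (rad lam r)) (1 + delta)
    <= Rpower (ln (rad lam s)) (1 + delta).
Proof.
  intros Hl Hd. set (e := delta / (2 * (1 + delta))).
  assert (He : 0 < e) by (apply Rdiv_lt_0_compat; lra).
  set (A := ln 6 + (1 + delta) * ln 2 - (1 + delta) * ln e).
  destruct (le_rad lam Hl) as [r1 Hr1].
  exists (Rmax (Rmax r1 (- 2 * ln lam + 1)) (Rmax (1 - ln lam) (2 / delta * A - ln lam))).
  intros r s Hr Hs.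
  assert (Hra : Rmax r1 (- 2 * ln lam + 1) <= r) by (eapply Rle_trans; [apply Rmax_l | apply Hr]).
  assert (Hrb : Rmax (1 - ln lam) (2 / delta * A - ln lam) <= r) by (eapply Rle_trans; [apply Rmax_r | apply Hr]).
  assert (Hrc : r1 <= r) by (eapply Rle_trans; [apply Rmax_l | apply Hra]).
  assert (Hrd : - 2 * ln lam + 1 <= r) by (eapply Rle_trans; [apply Rmax_r | apply Hra]).
  assert (Hre : 1 - ln lam <= r) by (eapply Rle_trans; [apply Rmax_l | apply Hrb]).
  assert (Hrf : 2 / delta * A - ln lam <= r) by (eapply Rle_trans; [apply Rmax_r | apply Hrb]).
  specialize (Hr1 r Hrc).
  assert (HX := rad_pos lam r Hl). set (X := rad lam r) in *.
  apply Rle_trans with (Rpower (X / 2) (1 + delta)).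
  - assert (HlX : ln X = ln lam + r) by now apply ln_rad.
    assert (HXe : X = exp (ln X)) by now rewrite exp_ln.
    set (y := ln X) in *. unfold Rpower.
    replace (6 * X) with (exp (ln 6 + y)) by (rewrite exp_plus, exp_ln, <- HXe; lra).
    rewrite <- exp_plus. apply exp_le_mono.
    unfold Rdiv at 1. rewrite ln_mult, ln_Rinv by lra. fold y.
    assert (Hy : ln y <= e * y - ln e) by (apply ln_le_linear; lra).
    assert (Hy1 : (1 + delta) * ln y <= (1 + delta) * (e * y - ln e)) by (apply Rmult_le_compat_l; lra).
    assert (Hy2 : (1 + delta) * (e * y - ln e) = delta * y / 2 - (1 + delta) * ln e) by (unfold e; field; lra).
    assert (Hy3 : A <= delta * y / 2).
    { replace A with (delta / 2 * (2 / delta * A)) by (field; lra).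
      replace (delta * y / 2) with (delta / 2 * y) by field. apply Rmult_le_compat_l; lra. }
    unfold A in Hy3. lra.
  - apply Rle_Rpower_l; [lra|]. rewrite ln_rad by auto. lra.
Qed.

Lemma rad_iter_real lam x k : Eiter lam k (x, 0) = (Nat.iter k (rad lam) x, 0).
Proof.
  induction k as [|k IH]; [reflexivity|].
  change (Eiter lam (S k) (x, 0)) with (Emap lam (Eiter lam k (x, 0))). rewrite IH.
  unfold Emap; simpl. rewrite cos_0, sin_0. unfold rad. f_equal; ring.
Qed.

(** Since [t * p (/ t)] increases, halving the argument of [p] at most halves its value. *)
Lemma gauge_double h p t0 :
  (forall x, x > / t0 -> p x > 0) ->
  (forall s t, 0 < s <= t -> t < t0 -> s * p (/ s) <= t * p (/ t)) ->
  (forall t, 0 < t < t0 -> h t = t / p (/ t)) ->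
  forall t, 0 < t -> 2 * t < t0 -> h (2 * t) <= 4 * h t.
Proof.
  intros Hp Htp Hh t Ht Ht2. rewrite !Hh by lra.
  assert (H1 := Htp t (2 * t) ltac:(lra) Ht2).
  assert (0 < p (/ t)) by (apply Hp, Rinv_lt_contravar; nra).
  assert (0 < p (/ (2 * t))) by (apply Hp, Rinv_lt_contravar; nra).
  apply Rmult_le_reg_r with (p (/ (2 * t)) * p (/ t)); [nra|].
  replace (2 * t / p (/ (2 * t)) * (p (/ (2 * t)) * p (/ t))) with (2 * (t * p (/ t))) by (field; lra).
  replace (4 * (t / p (/ t)) * (p (/ (2 * t)) * p (/ t))) with (2 * (2 * t * p (/ (2 * t)))) by (field; lra).
  lra.
Qed.

Lemma is_diam_close U d z w : is_diam U d -> U z -> U w -> cdist z w <= d.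
Proof.
  intros [[HU _]|[_ [Hub _]]] Hz Hw; [destruct (HU z Hz)|]. apply Hub. exists z, w; auto.
Qed.

Lemma is_diam_nonneg U d : is_diam U d -> 0 <= d.
Proof.
  intros H. destruct (H) as [[_ ->]|[[z Hz] _]]; [lra|].
  apply Rle_trans with (cdist z z); [apply cdist_pos | now apply (is_diam_close U)].
Qed.

Lemma hval_nonneg h t0 d : (forall t, 0 < t < t0 -> h t > 0) -> d < t0 -> 0 <= hval h d.
Proof.
  intros H Hd. unfold hval. destruct (Rle_dec d 0); [lra|]. left; apply H; lra.
Qed.

Lemma close_trans a b z w v : close a z w -> close b w v -> close (a + b) z v.
Proof.
  intros [H1 H2] [H3 H4]. split.
  - replace (fst z - fst v) with ((fst z - fst w) + (fst w - fst v)) by ring.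
    eapply Rle_trans; [apply Rabs_triang | lra].
  - replace (snd z - snd v) with ((snd z - snd w) + (snd w - snd v)) by ring.
    eapply Rle_trans; [apply Rabs_triang | lra].
Qed.

Lemma close_sym d z w : close d z w -> close d w z.
Proof. intros [H1 H2]. split; rewrite Rabs_minus_sym; auto. Qed.

Lemma close_mono a b z w : a <= b -> close a z w -> close b z w.
Proof. intros H [H1 H2]. split; lra. Qed.

Lemma Hh_infinite_Xset
  (lam x0 : R) (psi : R -> R) (t0 : R) (p h : R -> R) (delta : R)
  (Hlam : 0 < lam < 1)
  (Hpsi_incr : forall x y, x0 <= x <= y -> psi x <= psi y)
  (Hpsi_inf : forall M, exists X, forall x, x >= X -> psi x >= M)
  (Hpsi_o : forall eps, eps > 0 -> exists X, forall x, x >= X -> psi x <= eps * x)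
  (Ht0 : 0 < t0)
  (Hh_pos : forall t, 0 < t < t0 -> h t > 0)
  (Hh_lim : forall eps, eps > 0 -> exists eta, eta > 0 /\
              forall t, 0 < t < eta -> t < t0 -> h t < eps)
  (Hp_pos : forall x, x > / t0 -> p x > 0)
  (Hp_incr : forall x y, / t0 < x <= y -> p x <= p y)
  (Htp_incr : forall s t, 0 < s <= t -> t < t0 -> s * p (/ s) <= t * p (/ t))
  (Hh_def : forall t, 0 < t < t0 -> h t = t / p (/ t))
  (Hdelta : delta > 0) T :
  (forall t, t >= T -> p (t * Rpower (ln t) (1 + delta) / psi t) <= psi (ln t)) ->
  Hh_infinite h t0 (Xset lam x0 psi).
Proof.
  intros HT M0. set (M := Rmax M0 1).
  assert (HM : 1 <= M) by apply Rmax_r.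
  destruct (le_rad lam) as [r1 Hr1]; [lra|].
  destruct (Rpower_scale_step lam delta) as [r2 Hr2]; [lra | lra |].
  destruct (Hpsi_o (/ 4)) as [r3 Hr3]; [lra|].
  destruct (Hpsi_o (t0 / 2)) as [r4 Hr4]; [lra|].
  destruct (Hpsi_inf (16 * 433)) as [r5 Hr5].
  assert (Hln : ln lam < 0) by (rewrite <- ln_1; apply ln_increasing; lra).
  (* The term [- ln lam] offsets the shift in [ln (X r) = ln lam + r], so that logarithms of radii
     also stay above [x0]. *)
  set (R0 := 12 + Rabs r1 + Rabs r2 + Rabs r3 + Rabs r4 + Rabs r5 + Rabs T + Rabs x0 - ln lam).
  assert (HR : 12 <= R0 /\ r1 <= R0 /\ r2 <= R0 /\ r3 <= R0 /\ r4 <= R0 /\ r5 <= R0 /\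
     T <= R0 /\ x0 - ln lam <= R0 /\ 12 - ln lam <= R0).
  { unfold R0. assert (Ha := Rle_abs). assert (Hb := Rabs_pos).
    pose proof (Ha r1); pose proof (Ha r2); pose proof (Ha r3); pose proof (Ha r4);
    pose proof (Ha r5); pose proof (Ha T); pose proof (Ha x0).
    pose proof (Hb r1); pose proof (Hb r2); pose proof (Hb r3); pose proof (Hb r4);
    pose proof (Hb r5); pose proof (Hb T); pose proof (Hb x0). repeat split; lra. }
  clearbody R0. destruct HR as [HR0 [HR1 [HR2 [HR3 [HR4 [HR5 [HRT [HRx HRl]]]]]]]].
  assert (c1 : 0 < lam) by lra.
  assert (c2 : forall r, R0 <= r -> R0 <= rad lam r /\ 12 <= rad lam r).
  { intros r Hr. assert (r <= rad lam r) by (apply Hr1; lra). lra. }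
  assert (c3 : forall x y, R0 <= x <= y -> psi x <= psi y) by (intros; apply Hpsi_incr; lra).
  assert (c4 : forall x, R0 <= x -> psi x <= x / 4).
  { intros x Hx. assert (psi x <= / 4 * x) by (apply Hr3; lra). lra. }
  assert (c5 : forall x, R0 <= x -> 16 * 433 <= psi x) by (intros; apply Rge_le, Hr5; lra).
  assert (c6 : forall x, R0 <= x -> psi x < t0 * x).
  { intros x Hx. assert (psi x <= t0 / 2 * x) by (apply Hr4; lra). nra. }
  assert (c7 : forall r, R0 <= r -> p (rad lam r * Rpower (ln (rad lam r)) (1 + delta) / psi (rad lam r)) <= psi r).
  { intros r Hr. apply Rle_trans with (psi (ln (rad lam r))).
    - apply HT. destruct (c2 r Hr); lra.
    - rewrite ln_rad by auto. apply Hpsi_incr; lra. }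
  assert (c8 : forall r, R0 <= r -> 1 <= ln (rad lam r)) by (intros; rewrite ln_rad by auto; lra).
  assert (c9 : forall r s, R0 <= r -> rad lam r <= s ->
     6 * rad lam r * Rpower (ln (rad lam r)) (1 + delta) <= Rpower (ln (rad lam s)) (1 + delta)).
  { intros r s Hr Hs. apply Hr2; lra. }
  assert (Hm0 : 0 < mass_const) by (unfold mass_const; lra).
  (* With this root the total mass, at most [432 * mass_const * (4 * M + 2) / INR (nrows psi r)], is
     at most one half. *)
  destruct (Hpsi_inf (17 * (864 * mass_const * (4 * M + 2)))) as [r6 Hr6].
  set (r := Rmax (R0 + 1) r6).
  assert (Hr0 : R0 + 1 <= r) by apply Rmax_l. assert (Hr : R0 <= r) by lra.
  assert (HN : 864 * mass_const * (4 * M + 2) <= INR (nrows psi r)).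
  { destruct (nrows_spec psi R0 c5 r Hr) as [_ HN].
    assert (psi r >= 17 * (864 * mass_const * (4 * M + 2))) by (apply Hr6, Rle_ge, Rmax_r). lra. }
  destruct (c2 r Hr) as [_ HX12].
  set (delta0 := Rmin (/ rad lam r) t0 / 2).
  assert (HX0 : 0 < / rad lam r) by (apply Rinv_0_lt_compat; lra).
  assert (Hd0 : 0 < Rmin (/ rad lam r) t0) by (apply Rmin_glb_lt; lra).
  assert (Hd1 := Rmin_l (/ rad lam r) t0). assert (Hd2 := Rmin_r (/ rad lam r) t0).
  exists delta0. split; [unfold delta0; lra|].
  intros U d [Hcov Hdiam].
  apply NNPP; intros Hno.
  assert (Hsum : forall n, rsum (fun k => hval h (d k)) n <= M).
  { intros n. apply Rle_trans with (rsum (fun k => hval h (d k)) (S n)).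
    - apply rsum_incr; [|lia]. intros k. apply (hval_nonneg h t0); auto.
      destruct (Hdiam k); unfold delta0 in *; lra.
    - rewrite <- rsum_sum_f_R0. apply Rnot_lt_le. intros Hlt. apply Hno. exists n.
      assert (M0 <= M) by apply Rmax_l. lra. }
  assert (Hd_nn : forall k, 0 <= d k) by (intros k; apply (is_diam_nonneg (U k)), Hdiam).
  (* The amount of thickening: half the diameter if that is positive, at the cost of a factor 4. A
     set of diameter zero costs nothing in the cover, so its thickening is paid for by the summable
     [(/ 2) ^ k]. *)
  assert (Ht : forall k, exists e, 0 < e /\ d k + 2 * e < / rad lam r /\ d k + 2 * e < t0 /\
     h (d k + 2 * e) <= 4 * hval h (d k) + (/ 2) ^ k).
  { intros k. assert (Hpk : 0 < (/ 2) ^ k) by (apply pow_lt; lra).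
    destruct (Hdiam k) as [_ Hdk]. unfold delta0 in Hdk. unfold hval. destruct (Rle_dec (d k) 0) as [L|L].
    - assert (E : d k = 0) by (specialize (Hd_nn k); lra). rewrite E.
      destruct (Hh_lim _ Hpk) as [eta [Heta Hh]].
      assert (Hq : 0 < Rmin eta (Rmin (/ rad lam r) t0)) by (apply Rmin_glb_lt; lra).
      assert (Hq1 := Rmin_l eta (Rmin (/ rad lam r) t0)). assert (Hq2 := Rmin_r eta (Rmin (/ rad lam r) t0)).
      exists (Rmin eta (Rmin (/ rad lam r) t0) / 4). repeat split; try lra.
      left. rewrite Rmult_0_r, !Rplus_0_l. apply Hh; lra.
    - exists (d k / 2). replace (d k + 2 * (d k / 2)) with (2 * d k) by field. repeat split; try lra.
      assert (h (2 * d k) <= 4 * h (d k)) by (apply (gauge_double h p t0); auto; lra). lra. }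
  set (e := fun k => proj1_sig (constructive_indefinite_description _ (Ht k))).
  assert (He : forall k, 0 < e k /\ d k + 2 * e k < / rad lam r /\ d k + 2 * e k < t0 /\
     h (d k + 2 * e k) <= 4 * hval h (d k) + (/ 2) ^ k).
  { intros k. exact (proj2_sig (constructive_indefinite_description _ (Ht k))). }
  clearbody e. clear Ht.
  set (V := fun k w => exists u, U k u /\ close (e k) w u).
  set (c := 432 * mass_const / INR (nrows psi r)).
  assert (HNpos : 0 < INR (nrows psi r)) by nra.
  assert (Hc : 0 < c) by (apply Rdiv_lt_0_compat; lra).
  assert (Hmass : forall k, exists n0, forall n, (n0 <= n)%nat ->
    mass lam psi n r (V k) <= c * (4 * hval h (d k) + (/ 2) ^ k)).
  { intros k. destruct (He k) as [He1 [He2 [He3 He4]]].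
    destruct (mass_gauge lam psi R0 c1 c2 c3 c4 c5 p t0 delta Ht0 Hdelta Hp_pos Hp_incr Htp_incr
      c6 c7 c8 c9 r (V k) (d k + 2 * e k) Hr) as [n0 Hn0]; auto.
    - specialize (Hd_nn k); lra.
    - intros w w' [u [Hu Hwu]] [u' [Hu' Hwu']] _ _.
      replace (d k + 2 * e k) with (e k + (d k + e k)) by ring.
      apply close_trans with u; auto. apply close_trans with u'; [|now apply close_sym].
      apply close_mono with (cdist u u'); [|apply close_cdist].
      apply (is_diam_close (U k)); auto. apply Hdiam.
    - exists n0. intros n Hn. eapply Rle_trans; [apply Hn0; auto|]. fold c.
      apply Rmult_le_compat_l; [lra|]. rewrite <- Hh_def; auto. specialize (Hd_nn k); lra. }
  assert (Hlight : light lam psi R0 r V (/ 2)).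
  { split; auto. intros K.
    destruct (bounded_choice (fun k n => mass lam psi n r (V k) <= c * (4 * hval h (d k) + (/ 2) ^ k)) K)
      as [n Hn].
    - intros k n n' Hnn H. eapply Rle_trans; [apply (mass_le lam psi R0); eauto | auto].
    - intros k _. destruct (Hmass k) as [n0 Hn0]. exists n0. apply Hn0. lia.
    - exists n. apply Rle_trans with (rsum (fun k => c * (4 * hval h (d k) + (/ 2) ^ k)) K).
      + apply rsum_le; intros; now apply Hn.
      + rewrite rsum_scal, rsum_plus, rsum_scal.
        assert (H1 := Hsum K). assert (H2 := rsum_geom K).
        apply Rle_trans with (c * (4 * M + 2)).
        * apply Rmult_le_compat_l; lra.
        * unfold c. apply Rmult_le_reg_r with (INR (nrows psi r)); auto.
          replace (432 * mass_const / INR (nrows psi r) * (4 * M + 2) * INR (nrows psi r))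
            with (432 * mass_const * (4 * M + 2)) by (field; lra). lra. }
  destruct (light_point lam psi R0 c1 c2 c4 c5 r V (/ 2) Hlight) as [r_ [z [Hz0 [Hz1 [Hz2 Hz3]]]]]; [lra|].
  destruct (Hcov z) as [k Hk].
  - intros m. rewrite rad_iter_real. destruct (Hz2 m) as [Hb1 Hb2].
    assert (Hrm : Nat.iter m (rad lam) x0 < r_ m).
    { clear - Hz0 Hz1 c1 HRx Hln Hr0. induction m as [|m IH]; simpl.
      - lra.
      - apply Rlt_le_trans with (rad lam (r_ m)); [|apply Hz1].
        apply Rmult_lt_compat_l; auto. now apply exp_increasing. }
    destruct (Hz1 m) as [Hrm0 _]. simpl fst. split; [lra|]. split; [lra|].
    assert (psi (r_ m) <= psi (fst (Eiter lam m z))) by (apply Hpsi_incr; lra).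
    assert (Hb := c5 _ Hrm0). lra.
  (* Since [z] is in [U k], the thickened [V k] contains all points [e k]-close to [z], contrary to
     the choice of [z]. *)
  - destruct (He k) as [He1 _]. destruct (Hz3 k (e k) He1) as [w [Hw1 Hw2]].
    apply Hw2. exists z. split; auto. now apply close_sym.
Qed.

(** * Coverings and null sets *)

(** [d] holds upper bounds for diameters, which simply scale under pull-backs; exact diameters
    return only in [null_Hh_zero]. *)
Definition covers (g : R -> R) (D : R) (A : C -> Prop) (B : R) : Prop :=
  exists (U : nat -> C -> Prop) (d : nat -> R),
    (forall z, A z -> exists k, U k z) /\
    (forall k z w, U k z -> U k w -> cdist z w <= d k) /\
    (forall k, 0 <= d k <= D) /\
    (forall n, rsum (fun k => g (d k)) n <= B).

Lemma covers_sub g D A A' B B' :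
  (forall z, A' z -> A z) -> B <= B' -> covers g D A B -> covers g D A' B'.
Proof.
  intros HA HB [U [d [H1 [H2 [H3 H4]]]]]. exists U, d. repeat split; auto; try apply H3.
  intros n. eapply Rle_trans; [apply H4 | auto].
Qed.

Lemma covers_mesh g D D' A B : D <= D' -> covers g D A B -> covers g D' A B.
Proof.
  intros HD [U [d [H1 [H2 [H3 H4]]]]]. exists U, d. repeat split; auto; [apply H3|].
  apply Rle_trans with D; [apply H3 | auto].
Qed.

Lemma covers_one g D A d :
  g 0 = 0 -> 0 <= g d -> 0 <= d <= D -> (forall z w, A z -> A w -> cdist z w <= d) ->
  covers g D A (g d).
Proof.
  intros Hg0 Hgd Hd HA.
  exists (fun k => match k with O => A | S _ => fun _ => False end),
    (fun k => match k with O => d | S _ => 0 end).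
  repeat split.
  - intros z Hz. exists 0%nat; auto.
  - intros [|k] z w Hz Hw; [auto | contradiction].
  - destruct k; lra.
  - destruct k; lra.
  - intros n. assert (H : (n = 0)%nat \/ rsum (fun k => g (match k with O => d | S _ => 0 end)) n = g d).
    { induction n as [|n IH]; [left; reflexivity|]. right. simpl. destruct IH as [->|IH].
      - simpl; ring.
      - rewrite IH. destruct n; [simpl in IH; simpl; lra | rewrite Hg0; ring]. }
    destruct H as [->|H]; [simpl; lra | lra].
Qed.

Lemma covers_union g D (A : nat -> C -> Prop) (B : nat -> R) B0 :
  (forall d, 0 <= d <= D -> 0 <= g d) -> (forall i, covers g D (A i) (B i)) ->
  (forall n, rsum B n <= B0) -> covers g D (fun z => exists i, A i z) B0.
Proof.
  intros Hg HA HB.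
  set (U := fun i => proj1_sig (constructive_indefinite_description _ (HA i))).
  assert (HU : forall i, exists d, (forall z, A i z -> exists k, U i k z) /\
    (forall k z w, U i k z -> U i k w -> cdist z w <= d k) /\
    (forall k, 0 <= d k <= D) /\ (forall n, rsum (fun k => g (d k)) n <= B i)).
  { intros i. exact (proj2_sig (constructive_indefinite_description _ (HA i))). }
  set (d := fun i => proj1_sig (constructive_indefinite_description _ (HU i))).
  assert (Hd : forall i, (forall z, A i z -> exists k, U i k z) /\
    (forall k z w, U i k z -> U i k w -> cdist z w <= d i k) /\
    (forall k, 0 <= d i k <= D) /\ (forall n, rsum (fun k => g (d i k)) n <= B i)).
  { intros i. exact (proj2_sig (constructive_indefinite_description _ (HU i))). }
  clearbody d U.
  exists (fun m => U (fst (of_nat m)) (snd (of_nat m))), (fun m => d (fst (of_nat m)) (snd (of_nat m))).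
  repeat split.
  - intros z [i Hi]. destruct (Hd i) as [H1 _]. destruct (H1 z Hi) as [k Hk].
    exists (to_nat (i, k)). rewrite cancel_of_to. exact Hk.
  - intros m. apply (Hd (fst (of_nat m))).
  - apply (Hd (fst (of_nat k))).
  - apply (Hd (fst (of_nat k))).
  - intros n. apply Rle_trans with (rsum (fun i => rsum (fun k => g (d i k)) n) n).
    + apply (rsum_cantor (fun i k => g (d i k))). intros i k. apply Hg, Hd.
    + apply Rle_trans with (rsum B n); auto. apply rsum_le; intros i _. apply Hd.
Qed.

Lemma covers_finite g D (A : nat -> C -> Prop) B n :
  0 <= D -> g 0 = 0 -> (forall d, 0 <= d <= D -> 0 <= g d) -> 0 <= B ->
  (forall i, (i < n)%nat -> covers g D (A i) B) ->
  covers g D (fun z => exists i, (i < n)%nat /\ A i z) (INR n * B).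
Proof.
  intros HD Hg0 Hg HB HA.
  apply (covers_union g D (fun i z => (i < n)%nat /\ A i z) (fun i => if Nat.ltb i n then B else 0)); auto.
  - intros i. destruct (Nat.ltb_spec i n) as [L|L].
    + apply covers_sub with (A i) B; [tauto | lra | auto].
    + rewrite <- Hg0. apply covers_one; try lra. intros z w [Hz _]; lia.
  - intros m. assert (H : rsum (fun i => if Nat.ltb i n then B else 0) m = INR (min m n) * B).
    { induction m as [|m IH]; [simpl; ring|]. simpl rsum. rewrite IH.
      destruct (Nat.ltb_spec m n).
      - rewrite !Nat.min_l by lia. rewrite S_INR; ring.
      - rewrite !Nat.min_r by lia. ring. }
    rewrite H. apply Rmult_le_compat_r; auto. apply le_INR. lia.
Qed.

(** The contraction is moved into the gauge, so that the same cover serves and only [g (c * d)] has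
    to be estimated. *)
Lemma covers_pull g c D A A' (f : C -> C) B :
  0 < c -> (forall z, A' z -> A (f z)) ->
  (forall z w, A' z -> A' w -> cdist z w <= c * cdist (f z) (f w)) ->
  covers (fun d => g (c * d)) D A B -> covers g (c * D) A' B.
Proof.
  intros Hc HA Hf [U [d [H1 [H2 [H3 H4]]]]].
  exists (fun k z => A' z /\ U k (f z)), (fun k => c * d k). repeat split; auto.
  - intros z Hz. destruct (H1 (f z) (HA z Hz)) as [k Hk]. exists k; auto.
  - intros k z w [Hz Hz'] [Hw Hw']. eapply Rle_trans; [apply Hf; auto|].
    apply Rmult_le_compat_l; [lra | now apply (H2 k)].
  - destruct (H3 k). apply Rmult_le_pos; lra.
  - destruct (H3 k). apply Rmult_le_compat_l; lra.
Qed.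

Lemma covers_gauge_le g g' m D A B :
  0 <= m -> (forall d, 0 <= d <= D -> g' d <= m * g d) ->
  covers g D A B -> covers g' D A (m * B).
Proof.
  intros Hm Hg [U [d [H1 [H2 [H3 H4]]]]]. exists U, d. repeat split; auto; try apply H3.
  intros n. apply Rle_trans with (rsum (fun k => m * g (d k)) n).
  - apply rsum_le; intros; now apply Hg.
  - rewrite rsum_scal. apply Rmult_le_compat_l; auto.
Qed.

Definition null (h : R -> R) (A : C -> Prop) : Prop :=
  forall D eps, 0 < D -> 0 < eps -> covers (hval h) D A eps.

Lemma hval_0 h : hval h 0 = 0.
Proof. unfold hval. destruct (Rle_dec 0 0); lra. Qed.

Lemma null_sub h A A' : (forall z, A' z -> A z) -> null h A -> null h A'.
Proof. intros H HA D eps HD He. apply covers_sub with A eps; auto; lra. Qed.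

Lemma diam_exists U D : 0 <= D -> (forall z w, U z -> U w -> cdist z w <= D) ->
  exists d, is_diam U d /\ 0 <= d <= D.
Proof.
  intros HD HU. destruct (classic (exists z, U z)) as [[z Hz]|Hn].
  - destruct (completeness (fun r => exists z w, U z /\ U w /\ r = cdist z w)) as [d Hd].
    + exists D. intros r [z' [w' [Hz' [Hw' ->]]]]; auto.
    + exists (cdist z z), z, z; auto.
    + assert (H : is_diam U d) by (right; split; [exists z|]; auto).
      exists d; split; auto. split; [now apply (is_diam_nonneg U)|].
      apply Hd. intros r [z' [w' [Hz' [Hw' ->]]]]; auto.
  - exists 0. split; [left|lra]. split; auto. intros z Hz; apply Hn; exists z; auto.
Qed.

Section Gauge.
Context (p h : R -> R) (t0 : R) (t0_pos : 0 < t0)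
  (h_pos : forall t, 0 < t < t0 -> h t > 0)
  (h_incr : forall s t, 0 < s <= t -> t < t0 -> h s <= h t)
  (p_pos : forall x, x > / t0 -> p x > 0)
  (p_incr : forall x y, / t0 < x <= y -> p x <= p y)
  (tp_incr : forall s t, 0 < s <= t -> t < t0 -> s * p (/ s) <= t * p (/ t))
  (h_def : forall t, 0 < t < t0 -> h t = t / p (/ t)).

Lemma hval_incr s t : 0 <= s <= t -> t < t0 -> hval h s <= hval h t.
Proof.
  intros Hst Ht. unfold hval. destruct (Rle_dec s 0), (Rle_dec t 0); try lra.
  - left; apply h_pos; lra.
  - apply h_incr; lra.
Qed.

Lemma hval_double t : 0 <= t -> 2 * t < t0 -> hval h (2 * t) <= 4 * hval h t.
Proof.
  intros H0 Ht. unfold hval. destruct (Rle_dec t 0), (Rle_dec (2 * t) 0); try lra.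
  apply (gauge_double h p t0); auto; lra.
Qed.

(** [h t / t = / p (/ t)] increases with [t]. *)
Lemma hval_shrink c t : 0 < c <= 1 -> 0 <= t < t0 -> hval h (c * t) <= c * hval h t.
Proof.
  intros Hc Ht. unfold hval. destruct (Rle_dec t 0).
  - destruct (Rle_dec (c * t) 0); nra.
  - destruct (Rle_dec (c * t) 0); [nra|].
    assert (Hct : 0 < c * t <= t) by nra.
    assert (H1 : / t0 < / t) by (apply Rinv_lt_contravar; nra).
    assert (H2 : / t <= / (c * t)) by (apply Rinv_le_contravar; lra).
    rewrite !h_def by lra.
    assert (Hp := p_incr (/ t) (/ (c * t)) (conj H1 H2)). assert (Hp0 := p_pos _ H1).
    unfold Rdiv. rewrite <- Rmult_assoc. apply Rmult_le_compat_l; [lra|].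
    apply Rinv_le_contravar; lra.
Qed.

Lemma null_Hh_zero A : null h A -> Hh_zero h t0 A.
Proof.
  intros HA delta Hdelta eps Heps.
  destruct (HA (delta / 2) eps) as [U [d [H1 [H2 [H3 H4]]]]]; [lra | lra |].
  assert (He : forall k, exists e, is_diam (U k) e /\ 0 <= e <= d k).
  { intros k. apply diam_exists; [apply H3 | apply H2]. }
  set (e := fun k => proj1_sig (constructive_indefinite_description _ (He k))).
  assert (Hed : forall k, is_diam (U k) (e k) /\ 0 <= e k <= d k).
  { intros k. exact (proj2_sig (constructive_indefinite_description _ (He k))). }
  exists U, e. split.
  - split; auto. intros k. destruct (Hed k) as [Hd He']. split; auto. specialize (H3 k). lra.
  - intros n. rewrite rsum_sum_f_R0. eapply Rle_trans; [|apply (H4 (S n))].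
    apply rsum_le; intros k _. destruct (Hed k) as [_ He']. specialize (H3 k).
    apply hval_incr; lra.
Qed.

Lemma null_union (A : nat -> C -> Prop) :
  (forall i, null h (A i)) -> null h (fun z => exists i, A i z).
Proof.
  intros HA D eps HD He. set (D' := Rmin D (t0 / 2)).
  assert (H1 : D' <= D) by apply Rmin_l. assert (H2 : D' <= t0 / 2) by apply Rmin_r.
  assert (H3 : 0 < D') by (apply Rmin_glb_lt; lra).
  apply covers_mesh with D'; auto.
  apply covers_union with (fun i => eps / 2 * (/ 2) ^ i).
  - intros d Hd. apply (hval_nonneg h t0); auto; lra.
  - intros i. apply HA; auto. assert (0 < (/ 2) ^ i) by (apply pow_lt; lra). nra.
  - intros n. rewrite (rsum_scal (eps / 2) (pow (/ 2))). assert (H := rsum_geom n). nra.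
Qed.

(** On a strip of height one [Emap_expand] bounds the growth of diameters under pull-back by 2,
    hence that of the gauge by 4; countably many strips fill the half-plane. *)
Lemma null_pull lam x A : 0 < lam -> 1 <= rad lam x -> null h A ->
  null h (fun z => x <= fst z /\ A (Emap lam z)).
Proof.
  intros Hl Hx HA.
  assert (Hstrip : forall y, null h (fun z => (x <= fst z /\ A (Emap lam z)) /\ y <= snd z <= y + 1)).
  { intros y D eps HD He. set (D' := Rmin (D / 2) (t0 / 4)).
    assert (H1 : D' <= D / 2) by apply Rmin_l. assert (H2 : D' <= t0 / 4) by apply Rmin_r.
    assert (H3 : 0 < D') by (apply Rmin_glb_lt; lra).
    apply covers_mesh with (2 * D'); [lra|].
    apply covers_pull with A (Emap lam); [lra | tauto | |].
    - intros z w [[Hz _] Hz'] [[Hw _] Hw'].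
      assert (H := Emap_expand lam 1 z w). rewrite Rmult_1_l in H. apply H; [lra | | |].
      + apply Rle_trans with (rad lam x); auto. now apply rad_le.
      + apply Rle_trans with (rad lam x); auto. now apply rad_le.
      + apply Rabs_le; lra.
    - replace eps with (4 * (eps / 4)) by field.
      apply covers_gauge_le with (hval h); [lra | | apply HA; lra].
      intros d Hd. apply hval_double; lra. }
  (* [b] tells the upper from the lower half-plane, where strip [i] runs from [- INR i - 1] to
     [- INR i]. *)
  apply null_sub with (fun z => exists b : nat, exists i,
    (x <= fst z /\ A (Emap lam z)) /\
    (match b with O => INR i | _ => - INR i - 1 end) <= snd z <= (match b with O => INR i | _ => - INR i - 1 end) + 1).
  - intros z Hz. destruct (Rle_dec 0 (snd z)) as [L|L].
    + exists 0%nat, (nfloor (snd z)). destruct (nfloor_spec (snd z) L). split; auto; lra.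
    + exists 1%nat, (nfloor (- snd z)). destruct (nfloor_spec (- snd z)); [lra|]. split; auto; lra.
  - apply null_union; intros b. apply null_union; intros i. apply Hstrip.
Qed.
End Gauge.

(** * Zero measure *)

Section Cost.
Context (lam : R) (psi : R -> R) (R0 : R).
Context (lam_pos : 0 < lam) (R0_ge : 4 <= R0)
  (rad_ge : forall r, R0 <= r -> 2 * R0 <= rad lam r)
  (psi_incr : forall x y, R0 <= x <= y -> psi x <= psi y)
  (psi_small : forall x, R0 <= x -> psi x <= x / 4)
  (psi_ge1 : forall x, R0 <= x -> 1 <= psi x).

Notation X := (rad lam).

(** The growth condition of [Xset] is weakened to staying right of [R0]; every orbit from [Xset] has
    a tail of this kind. *)
Definition Ytail (z : C) : Prop := forall k,
  R0 <= fst (Eiter lam k z) /\ Rabs (snd (Eiter lam k z)) < psi (fst (Eiter lam k z)).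

Definition slab (r b : R) (z : C) : Prop := Ytail z /\ r <= fst z <= r + b.

Lemma Ytail_Emap z : Ytail z -> Ytail (Emap lam z).
Proof. intros H k. rewrite Eiter_Emap. apply H. Qed.

(** The modulus of the image lies between [X r] and [3 * X r], and its imaginary part is at most a
    quarter of its real part. *)
Lemma slab_Emap r z : R0 <= r -> slab r 1 z -> X r / 2 <= fst (Emap lam z) <= 3 * X r.
Proof.
  intros Hr [HY Hz]. destruct (HY 1%nat) as [H1 H2]. simpl Eiter in *.
  assert (H3 := psi_small _ H1). assert (HX := rad_succ lam r lam_pos).
  assert (Hlo : X r <= X (fst z)) by (apply rad_le; lra).
  assert (Hhi : X (fst z) <= X (r + 1)) by (apply rad_le; lra).
  assert (HX0 := rad_pos lam r lam_pos).
  assert (Hn : fst (Emap lam z) ^ 2 + snd (Emap lam z) ^ 2 = X (fst z) ^ 2).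
  { simpl. assert (H := sin2_cos2 (snd z)). unfold Rsqr in H. unfold rad.
    transitivity ((lam * exp (fst z)) ^ 2 * (sin (snd z) * sin (snd z) + cos (snd z) * cos (snd z))); [ring|].
    rewrite H; ring. }
  assert (Hs : snd (Emap lam z) ^ 2 <= (fst (Emap lam z) / 4) ^ 2).
  { rewrite <- pow2_abs. apply pow_incr. split; [apply Rabs_pos | lra]. }
  assert (0 <= snd (Emap lam z) ^ 2) by apply pow2_ge_0.
  split.
  - apply sqr_le_reg; [lra|]. assert (X r ^ 2 <= X (fst z) ^ 2) by (apply pow_incr; lra). nra.
  - apply Rle_trans with (X (fst z)); [|lra]. apply sqr_le_reg; lra.
Qed.

(** The slab is cut into at most [2 * r] strips of unit height, on which [E] expands by [X r / 2],
    and the image of each into at most [4 * X r / b] slabs of width [b]. *)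
Lemma slab_step g r b D B :
  R0 <= r -> 0 < b <= X r -> 0 <= D -> 0 <= B -> g 0 = 0 ->
  (forall d, 0 <= d <= 2 / X r * D -> 0 <= g d) ->
  (forall r', X r / 2 <= r' <= 4 * X r ->
     covers (fun d => g (2 / X r * d)) D (slab r' b) B) ->
  covers g (2 / X r * D) (slab r 1) (8 * r * X r / b * B).
Proof.
  intros Hr Hb HD HB Hg0 Hg Hcov. assert (HX := rad_ge r Hr).
  set (J := S (nfloor (psi (r + 1)))). set (n := S (nfloor (3 * X r / b))).
  assert (Hpsi := psi_ge1 (r + 1) ltac:(lra)). assert (Hpsi' := psi_small (r + 1) ltac:(lra)).
  assert (HJ : psi (r + 1) < INR J <= psi (r + 1) + 1).
  { unfold J. rewrite S_INR. destruct (nfloor_spec (psi (r + 1))); lra. }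
  assert (H3b : 3 <= 3 * X r / b).
  { apply Rmult_le_reg_r with b; [lra|]. field_simplify; lra. }
  assert (Hn : 3 * X r / b < INR n <= 3 * X r / b + 1).
  { unfold n. rewrite S_INR. destruct (nfloor_spec (3 * X r / b)); lra. }
  assert (H2X : 0 < 2 / X r) by (apply Rdiv_lt_0_compat; lra).
  assert (H2D : 0 <= 2 / X r * D) by (apply Rmult_le_pos; lra).
  apply covers_sub with
    (fun z => exists j, (j < 2 * J)%nat /\ exists i, (i < n)%nat /\
       (slab r 1 z /\ - INR J + INR j <= snd z <= - INR J + INR j + 1 /\
        slab (X r / 2 + INR i * b) b (Emap lam z)))
    (INR (2 * J) * (INR n * B)).
  - intros z Hz. destruct (slab_Emap r z Hr Hz) as [Hlo Hhi].
    destruct (Hz) as [HY Hzr]. destruct (HY 0%nat) as [H1 H2]. simpl Eiter in *.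
    assert (Hp : psi (fst z) <= psi (r + 1)) by (apply psi_incr; lra).
    assert (Hs : - INR J < snd z < INR J) by (destruct (Rabs_def2 (snd z) (INR J)); lra).
    exists (nfloor (snd z + INR J)). destruct (nfloor_spec (snd z + INR J)) as [Hf1 Hf2]; [lra|].
    split; [apply INR_lt; rewrite mult_INR; simpl (INR 2); lra|].
    set (t := (fst (Emap lam z) - X r / 2) / b).
    assert (Ht : t * b = fst (Emap lam z) - X r / 2) by (unfold t; field; lra).
    assert (Ht0 : 0 <= t) by (apply Rmult_le_reg_r with b; lra).
    exists (nfloor t). destruct (nfloor_spec t Ht0) as [Hi1 Hi2].
    assert (Htn : t <= 3 * X r / b).
    { apply Rmult_le_reg_r with b; [lra|]. rewrite Ht.
      replace (3 * X r / b * b) with (3 * X r) by (field; lra). lra. }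
    split; [apply INR_lt; lra|]. split; [exact Hz|]. split; [lra|].
    split; [now apply Ytail_Emap | split].
    + assert (INR (nfloor t) * b <= t * b) by (apply Rmult_le_compat_r; lra). lra.
    + assert (t * b <= (INR (nfloor t) + 1) * b) by (apply Rmult_le_compat_r; lra). lra.
  - assert (Hnb : INR n <= 4 * X r / b).
    { assert (1 <= X r / b) by (apply Rmult_le_reg_r with b; [lra | field_simplify; lra]).
      unfold Rdiv in *; lra. }
    rewrite mult_INR. simpl (INR 2).
    replace (8 * r * X r / b * B) with (2 * r * (4 * X r / b * B)) by (field; lra).
    apply Rmult_le_compat; try lra.
    + apply Rmult_le_pos; lra.
    + apply Rmult_le_compat_r; lra.
  - assert (Hn0 : 0 <= INR n) by (apply pos_INR).
    apply covers_finite; auto; [apply Rmult_le_pos; auto|]. intros j _.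
    apply covers_finite; auto. intros i Hi.
    apply covers_pull with (slab (X r / 2 + INR i * b) b) (Emap lam); auto; [tauto | |].
    + intros z w [[_ Hz] [Hz' _]] [[_ Hw] [Hw' _]].
      assert (H := Emap_expand lam (X r) z w).
      assert (HE : X r * cdist z w <= 2 * cdist (Emap lam z) (Emap lam w)).
      { apply H; [lra | apply rad_le; lra | apply rad_le; lra | apply Rabs_le; lra]. }
      apply Rmult_le_reg_l with (X r); [lra|].
      replace (X r * (2 / X r * cdist (Emap lam z) (Emap lam w)))
        with (2 * cdist (Emap lam z) (Emap lam w)) by (field; lra). auto.
    + apply Hcov. assert (Hi' := pos_INR i).
      assert (INR i * b <= 3 * X r).
      { assert (Hin := lt_INR_succ i n Hi).
        replace (3 * X r) with (3 * X r / b * b) by (field; lra). apply Rmult_le_compat_r; lra. }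
      assert (0 <= INR i * b) by (apply Rmult_le_pos; lra). lra.
Qed.

Context (p h : R -> R) (t0 delta K : R) (t0_pos : 0 < t0) (delta_pos : 0 < delta) (K_ge : 1 <= K)
  (h_pos : forall t, 0 < t < t0 -> h t > 0)
  (h_incr : forall s t, 0 < s <= t -> t < t0 -> h s <= h t)
  (p_pos : forall x, x > / t0 -> p x > 0)
  (p_incr : forall x y, / t0 < x <= y -> p x <= p y)
  (tp_incr : forall s t, 0 < s <= t -> t < t0 -> s * p (/ s) <= t * p (/ t))
  (h_def : forall t, 0 < t < t0 -> h t = t / p (/ t))
  (psi_double : forall x, R0 <= x -> psi (2 * x) <= K * psi x)
  (psi_t0 : forall x, R0 <= x -> 64 * K ^ 3 * psi x < t0 * x)
  (rad_t0 : forall r, R0 <= r -> 16 * K ^ 3 <= t0 * X r)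
  (ln_rad_ge : forall r, R0 <= r -> r / 2 <= ln (X r) <= r)
  (ln_rad_ge1 : forall r, R0 <= r -> 1 <= ln (X r))
  (p_growth : forall r, R0 <= r ->
     Rpower (ln (X r)) (1 + delta) <= p (X r * ln (X r) / psi (X r)))
  (base_small : forall r, R0 <= r -> 8192 * (4 * K ^ 3) ^ 2 * r ^ 2 <= Rpower (X r / 4) delta)
  (step_small : forall r, R0 <= r -> 64 * r ^ 2 <= X r).

Lemma p_scale_le c y : 1 <= c -> 0 < y -> c < t0 * y -> p y <= c * p (y / c).
Proof.
  intros Hc Hy Hcy. assert (H := tp_incr (/ y) (c / y)).
  rewrite Rinv_inv in H. replace (/ (c / y)) with (y / c) in H by (field; lra).
  apply Rmult_le_reg_l with (/ y); [now apply Rinv_0_lt_compat|].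
  replace (/ y * (c * p (y / c))) with (c / y * p (y / c)) by (field; lra).
  assert (Hy' : 0 < / y) by now apply Rinv_0_lt_compat.
  apply H.
  - split; auto. unfold Rdiv. nra.
  - apply Rmult_lt_reg_r with y; auto. unfold Rdiv. rewrite Rmult_assoc, Rinv_l; lra.
Qed.

(** Up to constants, the counts [r * X r] and [r1 * X r1 / psi (X r1)] times [t / p (/ t)] leave
    [r * r1 / p (/ t)]. The growth hypothesis at [X r1] makes [p (/ t)] at least of order [r1 * L],
    so the cost is of order [r / L], which [base_small] brings below [/ r]. *)
Lemma slab_base r : R0 <= r -> covers (hval h) (t0 / 2) (slab r 1) (/ r).
Proof.
  intros Hr. assert (HX := rad_ge r Hr).
  assert (HK3 : 1 <= K ^ 3) by (apply pow_R1_Rle; auto).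
  (* [K ^ 3] replaces [psi (8 * X r1)] by [psi (X r1)]; one factor 2 passes from height to side, the
     other is that of [cdist_le]. *)
  set (Q := 4 * K ^ 3). assert (HQ : 4 <= Q) by (unfold Q; lra).
  assert (H2X : 0 < 2 / X r) by (apply Rdiv_lt_0_compat; lra).
  assert (HXt := rad_t0 r Hr).
  assert (HDt : 2 / X r * Q <= t0 / 2).
  { apply Rmult_le_reg_r with (X r); [lra|].
    replace (2 / X r * Q * X r) with (2 * Q) by (field; lra). unfold Q. lra. }
  set (L := Rpower (X r / 4) delta).
  assert (HL : 0 < L) by apply exp_pos.
  assert (Hbase := base_small r Hr). fold L in Hbase. fold Q in Hbase.
  set (B1 := 1024 * Q ^ 2 / (X r * L)).
  assert (HB1 : 0 <= B1).
  { unfold B1, Rdiv. apply Rmult_le_pos; [|left; apply Rinv_0_lt_compat; nra].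
    assert (0 <= Q ^ 2) by apply pow2_ge_0. lra. }
  apply covers_mesh with (2 / X r * Q); auto.
  apply covers_sub with (slab r 1) (8 * r * X r / 1 * B1); auto.
  { unfold B1. apply Rmult_le_reg_r with (r * L); [nra|].
    replace (8 * r * X r / 1 * (1024 * Q ^ 2 / (X r * L)) * (r * L)) with (8192 * Q ^ 2 * r ^ 2) by (field; lra).
    replace (/ r * (r * L)) with L by (field; lra). auto. }
  apply slab_step; auto; [lra | lra | apply hval_0 | |].
  { intros d Hd. apply (hval_nonneg h t0); auto; lra. }
  intros r1 Hr1. assert (Hr1' : R0 <= r1) by lra.
  assert (HX1 := rad_ge r1 Hr1'). assert (HpX1 := psi_ge1 (X r1) ltac:(lra)).
  assert (HpX1' := psi_small (X r1) ltac:(lra)).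
  set (D2 := Q * psi (X r1)). assert (HD2 : 0 <= D2) by (unfold D2; apply Rmult_le_pos; lra).
  assert (HD2Q : 2 / X r1 * D2 <= Q).
  { apply Rmult_le_reg_r with (X r1); [lra|].
    replace (2 / X r1 * D2 * X r1) with (Q * (2 * psi (X r1))) by (unfold D2; field; lra).
    apply Rmult_le_compat_l; lra. }
  assert (H2X1 : 0 < 2 / X r1) by (apply Rdiv_lt_0_compat; lra).
  apply covers_mesh with (2 / X r1 * D2); auto.
  set (t := 2 / X r * (2 / X r1 * D2)).
  assert (Ht0 : 0 < t).
  { unfold t, D2. repeat (apply Rmult_lt_0_compat; try lra). }
  assert (Htt : t < t0).
  { apply Rle_lt_trans with (2 / X r * Q); [|lra]. apply Rmult_le_compat_l; lra. }
  apply covers_sub with (slab r1 1) (8 * r1 * X r1 / psi (X r1) * hval h t); auto.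
  - destruct (ln_rad_ge r1 Hr1') as [Hl1 Hl2].
    assert (Hl3 := ln_rad_ge1 r1 Hr1').
    set (l := ln (X r1)) in *. set (y := X r1 * l / psi (X r1)).
    assert (Hy : 0 < y) by (apply Rdiv_lt_0_compat; nra).
    assert (Hlt : 16 * Q < t0 * y).
    { apply Rmult_lt_reg_r with (psi (X r1)); [lra|].
      replace (t0 * y * psi (X r1)) with (t0 * X r1 * l) by (unfold y; field; lra).
      assert (H := psi_t0 (X r1) ltac:(lra)). unfold Q.
      assert (H0 : 0 < t0 * X r1) by (apply Rmult_lt_0_compat; lra).
      assert (t0 * X r1 * 1 <= t0 * X r1 * l) by (apply Rmult_le_compat_l; lra). lra. }
    assert (Hps := p_scale_le (16 * Q) y ltac:(lra) Hy Hlt).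
    assert (Hg := p_growth r1 Hr1'). fold l y in Hg.
    rewrite Rpower_plus, Rpower_1 in Hg by lra.
    assert (HLl : L <= Rpower l delta) by (apply Rle_Rpower_l; lra).
    (* 16 is the 4 contained in [t] times the 4 of [l <= r1 <= 4 * X r]. *)
    assert (Hyt : y / (16 * Q) <= / t).
    { apply Rmult_le_reg_r with t; auto. rewrite Rinv_l by lra.
      replace (y / (16 * Q) * t) with (l / (4 * X r)) by (unfold y, t, D2; field; lra).
      apply Rmult_le_reg_r with (4 * X r); [lra|]. field_simplify; lra. }
    assert (Hyt0 : / t0 < y / (16 * Q)).
    { apply Rmult_lt_reg_r with (t0 * (16 * Q)); [nra|]. field_simplify; lra. }
    assert (Hpt := p_incr _ _ (conj Hyt0 Hyt)).
    assert (Hpt0 : 0 < p (/ t)) by (apply p_pos; lra).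
    assert (Hmain : l * L <= 16 * Q * p (/ t)).
    { apply Rle_trans with (l * Rpower l delta); [apply Rmult_le_compat_l; lra|].
      apply Rle_trans with (p y); auto. eapply Rle_trans; [apply Hps|].
      apply Rmult_le_compat_l; lra. }
    unfold hval. destruct (Rle_dec t 0); [lra|]. rewrite h_def by lra.
    unfold B1. apply Rmult_le_reg_r with (p (/ t) * (X r * L)); [apply Rmult_lt_0_compat; auto; apply Rmult_lt_0_compat; lra|].
    replace (1024 * Q ^ 2 / (X r * L) * (p (/ t) * (X r * L))) with (64 * Q * (16 * Q * p (/ t))) by (field; lra).
    replace (8 * r1 * X r1 / psi (X r1) * (t / p (/ t)) * (p (/ t) * (X r * L)))
      with (32 * Q * (r1 * L)) by (unfold t at 1, D2; field; lra).
    apply Rle_trans with (64 * Q * (l * L)); [|apply Rmult_le_compat_l; lra].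
    replace (64 * Q * (l * L)) with (32 * Q * (2 * l * L)) by ring.
    apply Rmult_le_compat_l; [lra|]. apply Rmult_le_compat_r; lra.
  - assert (Hht : 0 <= hval h t) by (apply (hval_nonneg h t0); auto).
    apply (slab_step (fun d => hval h (2 / X r * d))); auto; [lra | | |].
    + rewrite Rmult_0_r; apply hval_0.
    + intros d Hd. apply (hval_nonneg h t0); auto.
      apply Rle_lt_trans with t; auto. unfold t. apply Rmult_le_compat_l; lra.
    + intros r2 Hr2. unfold t.
      apply (covers_one (fun d => hval h (2 / X r * (2 / X r1 * d)))); [| exact Hht | lra |].
      { rewrite !Rmult_0_r; apply hval_0. }
      assert (Hpsi8 : psi (8 * X r1) <= K ^ 3 * psi (X r1)).
      { replace (8 * X r1) with (2 * (2 * (2 * X r1))) by ring.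
        assert (H1 := psi_double (X r1) ltac:(lra)).
        assert (H2 := psi_double (2 * X r1) ltac:(lra)).
        assert (H3 := psi_double (2 * (2 * X r1)) ltac:(lra)).
        assert (K * psi (2 * X r1) <= K * (K * psi (X r1))) by (apply Rmult_le_compat_l; lra).
        assert (K * psi (2 * (2 * X r1)) <= K * (K * (K * psi (X r1)))) by (apply Rmult_le_compat_l; lra).
        simpl. lra. }
      assert (Hsnd : forall z, slab r2 (psi (X r1)) z -> Rabs (snd z) <= K ^ 3 * psi (X r1)).
      { intros z [HY Hz]. destruct (HY 0%nat) as [H1 H2]. simpl Eiter in *.
        assert (psi (fst z) <= psi (8 * X r1)) by (apply psi_incr; lra). lra. }
      intros z w Hz Hw. replace D2 with (2 * (2 * (K ^ 3 * psi (X r1)))) by (unfold D2, Q; ring).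
      assert (Hkp : psi (X r1) <= K ^ 3 * psi (X r1)) by nra.
      apply cdist_le. split.
      * destruct Hz as [_ Hz], Hw as [_ Hw]. apply Rabs_le. lra.
      * assert (H1 := Hsnd z Hz). assert (H2 := Hsnd w Hw).
        eapply Rle_trans; [apply Rabs_triang|]. rewrite Rabs_Ropp. lra.
Qed.

(** The number of columns cancels the contraction [2 / X r], which [hval_shrink] passes to the
    gauge. The remaining [r] is beaten by the bound at the next level, where [/ r1 <= 2 / X r]; this
    is why the estimate carries the divisor [r]. *)
Lemma slab_covers n : forall r, R0 <= r ->
  covers (hval h) (t0 / 2 * (/ 2) ^ n) (slab r 1) ((/ 2) ^ n / r).
Proof.
  induction n as [|n IH]; intros r Hr.
  - replace (t0 / 2 * (/ 2) ^ 0) with (t0 / 2) by (simpl; ring).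
    replace ((/ 2) ^ 0 / r) with (/ r) by (simpl; field; lra). now apply slab_base.
  - assert (HX := rad_ge r Hr). assert (Hpow : 0 < (/ 2) ^ n <= 1).
    { split; [apply pow_lt; lra|]. rewrite <- (pow1 n). apply pow_incr; lra. }
    assert (H2X : 0 < 2 / X r) by (apply Rdiv_lt_0_compat; lra).
    assert (H2X' : 2 / X r <= / 2).
    { apply Rmult_le_reg_r with (X r); [lra|]. replace (2 / X r * X r) with 2 by (field; lra). lra. }
    set (D := t0 / 2 * (/ 2) ^ n). assert (HD : 0 < D) by (unfold D; nra).
    assert (HDt : D <= t0 / 2) by (unfold D; nra).
    set (B := 2 / X r * ((/ 2) ^ n * (2 / X r))).
    assert (HB : 0 <= B) by (unfold B; apply Rmult_le_pos; [lra | apply Rmult_le_pos; lra]).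
    apply covers_mesh with (2 / X r * D).
    { replace (t0 / 2 * (/ 2) ^ S n) with (/ 2 * D) by (unfold D; simpl; field).
      apply Rmult_le_compat_r; lra. }
    apply covers_sub with (slab r 1) (8 * r * X r / 1 * B); auto.
    { unfold B. apply Rmult_le_reg_r with (r * X r); [nra|].
      replace (8 * r * X r / 1 * (2 / X r * ((/ 2) ^ n * (2 / X r))) * (r * X r))
        with ((/ 2) ^ n * (32 * r ^ 2)) by (field; lra).
      replace ((/ 2) ^ S n / r * (r * X r)) with ((/ 2) ^ n * (X r / 2)) by (simpl; field; lra).
      apply Rmult_le_compat_l; [lra|]. assert (H := step_small r Hr). lra. }
    apply slab_step; auto; [lra | lra | apply hval_0 | |].
    { intros d Hd. apply (hval_nonneg h t0); auto.
      assert (2 / X r * D <= / 2 * D) by (apply Rmult_le_compat_r; lra). lra. }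
    intros r1 Hr1. apply covers_sub with (slab r1 1) (2 / X r * ((/ 2) ^ n / r1)); auto.
    + unfold B. apply Rmult_le_compat_l; [lra|]. apply Rmult_le_compat_l; [lra|].
      replace (2 / X r) with (/ (X r / 2)) by (field; lra). apply Rinv_le_contravar; lra.
    + apply covers_gauge_le with (hval h); [lra | | apply IH; lra].
      intros d Hd. apply (hval_shrink p h t0); auto; lra.
Qed.

Lemma Ytail_null : null h Ytail.
Proof.
  apply null_sub with (fun z => exists i, slab (R0 + INR i) 1 z).
  - intros z HY. destruct (HY 0%nat) as [H1 _]. simpl in H1.
    exists (nfloor (fst z - R0)). destruct (nfloor_spec (fst z - R0)); [lra|]. split; auto; lra.
  - apply (null_union h t0); auto. intros i D eps HD He. assert (Hi := pos_INR i).
    destruct (pow_lt_1_zero (/ 2)) with (y := Rmin (D / t0) eps) as [n Hn].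
    + rewrite Rabs_right; lra.
    + apply Rmin_glb_lt; auto. now apply Rdiv_lt_0_compat.
    + specialize (Hn n (le_n n)). assert (Hpow : 0 < (/ 2) ^ n) by (apply pow_lt; lra).
      rewrite Rabs_right in Hn by lra.
      assert (H1 := Rmin_l (D / t0) eps). assert (H2 := Rmin_r (D / t0) eps).
      apply covers_mesh with (t0 / 2 * (/ 2) ^ n).
      { replace D with (t0 * (D / t0)) by (field; lra). nra. }
      apply covers_sub with (slab (R0 + INR i) 1) ((/ 2) ^ n / (R0 + INR i)); auto.
      * apply Rmult_le_reg_r with (R0 + INR i); [lra|]. unfold Rdiv. rewrite Rmult_assoc, Rinv_l by lra. nra.
      * apply slab_covers. lra.
Qed.
End Cost.

(** * Growth of real orbits and the conclusion for measure zero *)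

Lemma sqr_le_exp A c a : 0 < c -> 0 < a ->
  exists r0, forall r, r0 <= r -> A * r ^ 2 <= c * exp (a * r).
Proof.
  intros Hc Ha. set (m := c * (a / 3) ^ 3).
  assert (Hm : 0 < m) by (apply Rmult_lt_0_compat; auto; apply pow_lt; lra).
  exists (Rmax 0 (A / m)). intros r Hr.
  assert (H0 : 0 <= r) by (eapply Rle_trans; [apply Rmax_l | apply Hr]).
  assert (H1 : A / m <= r) by (eapply Rle_trans; [apply Rmax_r | apply Hr]).
  assert (HA : A <= m * r).
  { replace A with (m * (A / m)) by (field; lra). apply Rmult_le_compat_l; lra. }
  assert (He : (a / 3 * r) ^ 3 <= exp (a * r)).
  { replace (a * r) with (a / 3 * r + (a / 3 * r + a / 3 * r)) by field. rewrite !exp_plus.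
    assert (H2 := exp_ineq1_le (a / 3 * r)).
    replace (exp (a / 3 * r) * (exp (a / 3 * r) * exp (a / 3 * r))) with (exp (a / 3 * r) ^ 3) by ring.
    apply pow_incr. assert (0 <= a / 3 * r) by (apply Rmult_le_pos; lra). lra. }
  apply Rle_trans with (m * r * r ^ 2).
  - apply Rmult_le_compat_r; auto. apply pow2_ge_0.
  - replace (m * r * r ^ 2) with (c * (a / 3 * r) ^ 3) by (unfold m; ring).
    apply Rmult_le_compat_l; lra.
Qed.

(** [f] is eventually positive, so a negative value at some [x >= 1] forces a fixed point beyond
    [x], while [x0] exceeds all fixed points above one. Applied at 1, this gives [1 < x0]. *)
Lemma rad_gt_id lam x0 : 0 < lam < exp (-1) ->
  (forall b, b > 1 -> lam * exp b = b -> x0 > b) ->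
  1 < x0 /\ forall x, x0 <= x -> x < rad lam x.
Proof.
  intros Hl Hx0. set (f := fun x => rad lam x - x).
  assert (Hf1 : f 1 < 0).
  { unfold f, rad. assert (exp (-1) * exp 1 = 1) by (rewrite <- exp_plus; replace (-1 + 1) with 0 by ring; apply exp_0).
    assert (0 < exp 1) by apply exp_pos. nra. }
  assert (Hcont : continuity f).
  { unfold f, rad. apply derivable_continuous. reg. }
  destruct (linear_le_exp 2 lam) as [r0 Hr0]; [lra|].
  assert (Hroot : forall x, 1 <= x -> f x < 0 -> exists b, x <= b /\ b > 1 /\ lam * exp b = b).
  { intros x Hx Hfx. set (y := Rmax r0 (x + 1)).
    assert (Hy1 : r0 <= y) by apply Rmax_l. assert (Hy2 : x + 1 <= y) by apply Rmax_r.
    destruct (IVT f x y) as [b [Hb Hfb]]; auto; [lra | |].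
    - unfold f, rad. specialize (Hr0 y Hy1). lra.
    - exists b. split; [apply Hb|].
      assert (b <> 1) by (intros ->; lra). unfold f, rad in Hfb. split; lra. }
  assert (H1 : 1 < x0).
  { destruct (Hroot 1) as [b [Hb1 [Hb2 Hb3]]]; auto; [lra|]. specialize (Hx0 b Hb2 Hb3). lra. }
  split; auto. intros x Hx. apply Rnot_le_lt. intros Hle.
  destruct Hle as [Hlt|Heq].
  - destruct (Hroot x) as [b [Hb1 [Hb2 Hb3]]]; [lra | unfold f; lra |].
    specialize (Hx0 b Hb2 Hb3). lra.
  - specialize (Hx0 x ltac:(lra) Heq). lra.
Qed.

(* Past [beta] the derivative of [rad lam x - x] is at least [x - 1 > 0], so each step gains at
   least as much as the first. *)
Lemma rad_iter_unbounded lam x0 M : 0 < lam -> 1 < x0 -> x0 < rad lam x0 ->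
  exists m, forall k, M <= Nat.iter (k + m) (rad lam) x0.
Proof.
  intros Hl Hx0 Hr. set (c := rad lam x0 - x0).
  assert (Hstep : forall x, x0 <= x -> x + c <= rad lam x).
  { intros x Hx. unfold c. replace (rad lam x) with (rad lam x0 * exp (x - x0)).
    - assert (H := exp_ineq1_le (x - x0)). nra.
    - unfold rad. rewrite Rmult_assoc, <- exp_plus. do 2 f_equal. ring. }
  assert (Hk : forall k, x0 + INR k * c <= Nat.iter k (rad lam) x0).
  { assert (Hc : 0 < c) by (unfold c; lra).
    induction k as [|k IH]; [simpl; lra|]. rewrite S_INR. simpl Nat.iter.
    assert (Hk := pos_INR k). specialize (Hstep (Nat.iter k (rad lam) x0)).
    assert (0 <= INR k * c) by nra. lra. }
  assert (Hc : 0 < c) by (unfold c; lra).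
  exists (S (nfloor (Rabs M / c))). intros k. eapply Rle_trans; [|apply Hk].
  assert (HM : 0 <= Rabs M / c) by (apply Rmult_le_pos; [apply Rabs_pos | left; now apply Rinv_0_lt_compat]).
  destruct (nfloor_spec _ HM) as [_ H1].
  assert (H2 : Rabs M / c <= INR (k + S (nfloor (Rabs M / c)))).
  { rewrite plus_INR, S_INR. assert (H := pos_INR k). lra. }
  assert (H3 : Rabs M / c * c <= INR (k + S (nfloor (Rabs M / c))) * c) by (apply Rmult_le_compat_r; lra).
  replace (Rabs M / c * c) with (Rabs M) in H3 by (field; lra).
  assert (H4 := Rle_abs M). lra.
Qed.

Lemma Hh_zero_Xset
  (lam x0 : R) (psi : R -> R) (t0 : R) (p h : R -> R) (delta : R)
  (Hlam : 0 < lam < exp (-1))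
  (Hx0 : forall b, b > 1 -> lam * exp b = b -> x0 > b)
  (Hpsi_pos : forall x, x >= x0 -> psi x > 0)
  (Hpsi_incr : forall x y, x0 <= x <= y -> psi x <= psi y)
  (Hpsi_inf : forall M, exists X, forall x, x >= X -> psi x >= M)
  (Hpsi_dbl : exists K X, forall x, x >= X -> psi (2 * x) <= K * psi x)
  (Hpsi_o : forall eps, eps > 0 -> exists X, forall x, x >= X -> psi x <= eps * x)
  (Ht0 : 0 < t0)
  (Hh_pos : forall t, 0 < t < t0 -> h t > 0)
  (Hh_incr : forall s t, 0 < s <= t -> t < t0 -> h s <= h t)
  (Hp_pos : forall x, x > / t0 -> p x > 0)
  (Hp_incr : forall x y, / t0 < x <= y -> p x <= p y)
  (Htp_incr : forall s t, 0 < s <= t -> t < t0 -> s * p (/ s) <= t * p (/ t))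
  (Hh_def : forall t, 0 < t < t0 -> h t = t / p (/ t))
  (Hdelta : delta > 0) T :
  (forall t, t >= T -> p (t * ln t / psi t) >= Rpower (ln t) (1 + delta)) ->
  Hh_zero h t0 (Xset lam x0 psi).
Proof.
  intros HT. destruct (rad_gt_id lam x0 Hlam Hx0) as [Hx1 Hrad].
  assert (c1 : 0 < lam) by lra.
  destruct Hpsi_dbl as [K0 [r1 Hr1]]. set (K := Rmax 1 K0).
  assert (HK : 1 <= K) by apply Rmax_l. assert (HK0 : K0 <= K) by apply Rmax_r.
  assert (HK3 : 1 <= K ^ 3) by (apply pow_R1_Rle; auto).
  destruct (linear_le_exp 2 lam c1) as [r2 Hr2].
  destruct (Hpsi_o (/ 4)) as [r3 Hr3]; [lra|].
  destruct (Hpsi_o (t0 / (128 * K ^ 3))) as [r4 Hr4]; [apply Rdiv_lt_0_compat; lra|].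
  destruct (Hpsi_inf 1) as [r5 Hr5].
  destruct (sqr_le_exp 64 lam 1 c1 Rlt_0_1) as [r6 Hr6].
  (* The coefficient is [lam / 4] to the power [delta], so the right-hand side is [X r / 4] to that
     power, as in [base_small]. *)
  destruct (sqr_le_exp (8192 * (4 * K ^ 3) ^ 2) (exp (delta * (ln lam - ln 4))) delta
    (exp_pos _) Hdelta) as [r7 Hr7].
  assert (Hln : ln lam < 0).
  { rewrite <- ln_1. apply ln_increasing; auto. assert (exp (-1) < 1); [|lra].
    rewrite <- exp_0. apply exp_increasing; lra. }
  set (R0 := 4 + Rabs r1 + Rabs r2 + Rabs r3 + Rabs r4 + Rabs r5 + Rabs r6 + Rabs r7 + Rabs T
    + Rabs x0 + 16 * K ^ 3 / t0 - 2 * ln lam).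
  assert (HR : 4 <= R0 /\ r1 <= R0 /\ r2 <= R0 /\ r3 <= R0 /\ r4 <= R0 /\ r5 <= R0 /\
     r6 <= R0 /\ r7 <= R0 /\ T <= R0 /\ x0 <= R0 /\ 16 * K ^ 3 / t0 <= R0 /\ 4 - 2 * ln lam <= R0).
  { assert (H16 : 0 < 16 * K ^ 3 / t0) by (apply Rdiv_lt_0_compat; lra).
    unfold R0. assert (Ha := Rle_abs). assert (Hb := Rabs_pos).
    pose proof (Ha r1); pose proof (Ha r2); pose proof (Ha r3); pose proof (Ha r4);
    pose proof (Ha r5); pose proof (Ha r6); pose proof (Ha r7); pose proof (Ha T); pose proof (Ha x0).
    pose proof (Hb r1); pose proof (Hb r2); pose proof (Hb r3); pose proof (Hb r4);
    pose proof (Hb r5); pose proof (Hb r6); pose proof (Hb r7); pose proof (Hb T); pose proof (Hb x0).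
    repeat split; lra. }
  clearbody R0.
  destruct HR as [HR0 [HR1 [HR2 [HR3 [HR4 [HR5 [HR6 [HR7 [HRT [HRx [HRt HRl]]]]]]]]]]].
  assert (H2r : forall r, R0 <= r -> 2 * r <= rad lam r) by (intros r Hr; apply Hr2; lra).
  assert (HY : null h (Ytail lam psi R0)).
  { apply (Ytail_null lam psi R0) with (p := p) (t0 := t0) (delta := delta) (K := K); auto.
    - intros r Hr. specialize (H2r r Hr). lra.
    - intros; apply Hpsi_incr; lra.
    - intros x Hx. assert (psi x <= / 4 * x) by (apply Hr3; lra). lra.
    - intros x Hx. apply Rge_le, Hr5; lra.
    - intros x Hx. apply Rle_trans with (K0 * psi x); [apply Hr1; lra|].
      apply Rmult_le_compat_r; auto. assert (psi x > 0) by (apply Hpsi_pos; lra). lra.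
    - intros x Hx. assert (Hp4 : psi x <= t0 / (128 * K ^ 3) * x) by (apply Hr4; lra).
      apply Rle_lt_trans with (64 * K ^ 3 * (t0 / (128 * K ^ 3) * x)).
      + apply Rmult_le_compat_l; lra.
      + replace (64 * K ^ 3 * (t0 / (128 * K ^ 3) * x)) with (t0 * x / 2) by (field; lra).
        assert (0 < t0 * x) by (apply Rmult_lt_0_compat; lra). lra.
    - intros r Hr. replace (16 * K ^ 3) with (t0 * (16 * K ^ 3 / t0)) by (field; lra).
      specialize (H2r r Hr). apply Rmult_le_compat_l; lra.
    - intros r Hr. rewrite ln_rad by auto. lra.
    - intros r Hr. rewrite ln_rad by auto. lra.
    - intros r Hr. apply Rge_le, HT. specialize (H2r r Hr). lra.
    - intros r Hr. eapply Rle_trans; [apply Hr7; lra|]. right.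
      unfold Rpower, Rdiv. rewrite ln_mult, ln_Rinv, ln_rad, <- exp_plus by (auto using rad_pos; lra).
      f_equal; ring.
    - intros r Hr. unfold rad. replace r with (1 * r) at 2 by ring. apply Hr6; lra. }
  apply (null_Hh_zero h t0); auto.
  destruct (rad_iter_unbounded lam x0 R0) as [m Hm]; auto.
  { apply Hrad; lra. }
  (* After [m] steps every orbit from [Xset] is right of [R0]; before that its real parts exceed
     [x0], where [rad lam] is at least one, as [null_pull] requires. *)
  assert (Hpull : forall n, null h (fun z =>
    (forall k, (k < n)%nat -> x0 <= fst (Eiter lam k z)) /\ Ytail lam psi R0 (Eiter lam n z))).
  { induction n as [|n IH].
    - apply null_sub with (Ytail lam psi R0); auto. intros z [_ Hz]; exact Hz.
    - eapply null_sub; [|apply (null_pull p h t0) with (lam := lam) (x := x0); auto; [|apply IH]].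
      + intros z [Hz1 Hz2]. split; [apply (Hz1 0%nat); lia|]. rewrite Eiter_Emap. split; auto.
        intros k Hk. rewrite Eiter_Emap. apply Hz1; lia.
      + assert (H := Hrad x0 ltac:(lra)). lra. }
  apply null_sub with (2 := Hpull m). intros z Hz. split.
  - intros k _. destruct (Hz k) as [_ [H _]]. lra.
  - intros k. assert (E : Eiter lam k (Eiter lam m z) = Eiter lam (k + m) z).
    { unfold Eiter. now rewrite Nat.iter_add. }
    rewrite E. destruct (Hz (k + m)%nat) as [H1 [_ H2]]. split; auto.
    rewrite rad_iter_real in H1. simpl fst in H1. specialize (Hm k). lra.
Qed.

Theorem theorem1p3
  (lam x0 : R) (psi : R -> R) (t0 : R) (p h : R -> R) (delta : R)
  (Hlam : 0 < lam < exp (-1))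
  (Hx0 : forall b, b > 1 -> lam * exp b = b -> x0 > b)
  (Hpsi_pos : forall x, x >= x0 -> psi x > 0)
  (Hpsi_incr : forall x y, x0 <= x <= y -> psi x <= psi y)
  (Hpsi_inf : forall M, exists X, forall x, x >= X -> psi x >= M)
  (Hpsi_dbl : exists K X, forall x, x >= X -> psi (2 * x) <= K * psi x)
  (Hpsi_o : forall eps, eps > 0 -> exists X, forall x, x >= X -> psi x <= eps * x)
  (Ht0 : 0 < t0)
  (Hh_pos : forall t, 0 < t < t0 -> h t > 0)
  (Hh_incr : forall s t, 0 < s <= t -> t < t0 -> h s <= h t)
  (Hh_cont : forall t, 0 < t < t0 -> continuity_pt h t)
  (Hh_lim : forall eps, eps > 0 -> exists eta, eta > 0 /\
              forall t, 0 < t < eta -> t < t0 -> h t < eps)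
  (Hp_pos : forall x, x > / t0 -> p x > 0)
  (Hp_incr : forall x y, / t0 < x <= y -> p x <= p y)
  (Htp_incr : forall s t, 0 < s <= t -> t < t0 -> s * p (/ s) <= t * p (/ t))
  (Hh_def : forall t, 0 < t < t0 -> h t = t / p (/ t))
  (Hdelta : delta > 0) :
  ((exists T, forall t, t >= T ->
      p (t * Rpower (ln t) (1 + delta) / psi t) <= psi (ln t)) ->
     Hh_infinite h t0 (Xset lam x0 psi)) /\
  ((exists T, forall t, t >= T ->
      p (t * ln t / psi t) >= Rpower (ln t) (1 + delta)) ->
     Hh_zero h t0 (Xset lam x0 psi)).
Proof.
  split; intros [T HT].
  - assert (Hlam1 : 0 < lam < 1).
    { assert (exp (-1) < 1); [|lra]. rewrite <- exp_0. apply exp_increasing; lra. }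
    apply (Hh_infinite_Xset lam x0 psi t0 p h delta) with (T := T); auto.
  - apply (Hh_zero_Xset lam x0 psi t0 p h delta) with (T := T); auto.
Qed.
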